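(* Let $E$ and $F$ be Banach spaces and let $T\colon E\to F$ be a contractive operator, with induced lattice-algebra homomorphism $\bar T\colon\mathrm{FBfA}[E]\to\mathrm{FBfA}[F]$. (i) $\bar T$ has dense range if and only if $T$ has dense range. (ii) If $T$ is a quotient map, then so is $\bar T$. (iii) If $\bar T$ is a bijection, then so is $T$. (iv) With the additional assumption that $\mathrm{FBfA}[E]$ and $\mathrm{FBfA}[F]$ are semiprime, $\bar T$ is injective if and only if $T^*(B_{F^*})$ is weak$^*$-dense in $B_{E^*}$.
   Context: All spaces are real. A vector lattice algebra is a real associative algebra that is also a vector lattice in which the product of positive elements is positive. An $f$-algebra is a vector lattice algebra such that $a\wedge b=0$ and $c\ge 0$ imply $(ac)\wedge b=0=(ca)\wedge b$. A Banach $f$-algebra is an $f$-algebra equipped with a complete, submultiplicative lattice norm. It is semiprime if $a^2=0$ implies $a=0$. A lattice-algebra homomorphism is a linear map preserving the lattice operations and the product. Contractive means of operator norm at most $1$. The free Banach $f$-algebra generated by a Banach space $E$ is a Banach $f$-algebra $\mathrm{FBfA}[E]$ together with a linear isometric embedding $\eta_E\colon E\to\mathrm{FBfA}[E]$ such that for every Banach $f$-algebra $A$ and every contractive operator $T\colon E\to A$ there exists a unique lattice-algebra homomorphism $\hat T\colon\mathrm{FBfA}[E]\to A$ satisfying $\hat T\circ\eta_E=T$ and $\|\hat T\|=\|T\|$. It exists and is unique up to isometric lattice-algebra isomorphism. For a contractive operator $T\colon E\to F$ between Banach spaces, $\bar T\colon\mathrm{FBfA}[E]\to\mathrm{FBfA}[F]$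 is the unique lattice-algebra homomorphism with $\|\bar T\|=\|T\|$ and $\bar T\eta_E=\eta_FT$. $B_{E^*}$ denotes the closed unit ball of $E^*$ and $T^*$ the adjoint of $T$. A quotient map is a surjective operator $T\colon E\to F$ inducing an isometric isomorphism $E/\ker T\to F$. *)

(* Defs.v *)
From HB Require Import structures.
From mathcomp Require Import all_boot all_order all_algebra.
From mathcomp Require Import all_classical all_reals all_analysis.
Import Order.TTheory GRing.Theory Num.Theory.
Import numFieldNormedType.Exports.

Set Implicit Arguments.
Unset Strict Implicit.
Unset Printing Implicit Defensive.

Local Open Scope classical_set_scope.
Local Open Scope ring_scope.

(* The order is not the one of [Order.Lattice] or [Num.POrderedZmodule]:
   Hierarchy-Builder cannot join these with normed modules, since
   [realDomainType] and [numDomainType] would have to inherit from the join.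
   [`|x|] is always the norm of [x]; the lattice modulus is [labs x] below. *)
HB.mixin Record Lmodule_isVectorLattice (R : realType) V
    of GRing.Lmodule R V := {
  vle : V -> V -> Prop ;
  vmeet : V -> V -> V ;
  vjoin : V -> V -> V ;
  vle_refl : forall x : V, vle x x ;
  vle_anti : forall x y : V, vle x y -> vle y x -> x = y ;
  vle_trans : forall y x z : V, vle x y -> vle y z -> vle x z ;
  vle_meet : forall x y z : V, vle z (vmeet x y) <-> vle z x /\ vle z y ;
  vjoin_le : forall x y z : V, vle (vjoin x y) z <-> vle x z /\ vle y z ;
  vle_add2r : forall z x y : V, vle x y -> vle (x + z) (y + z) ;
  vscale_ge0 : forall (a : R) (x : V), 0 <= a -> vle 0 x -> vle 0 (a *: x)
}.

#[short(type="vectorLatticeType")]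
HB.structure Definition VectorLattice (R : realType) :=
  {V of GRing.Lmodule R V & Lmodule_isVectorLattice R V}.

Definition labs (R : realType) (V : vectorLatticeType R) (x : V) : V :=
  vjoin x (- x).

(* Algebras are not assumed to be unital, so the product is not the one of a
   [pzRingType]: it is the semigroup law [( _ * _ )%g]. *)
HB.mixin Record VectorLattice_isAlgebra (R : realType) A
    of VectorLattice R A & Semigroup A := {
  vmulDl : forall x y z : A, ((x + y) * z)%g = (x * z)%g + (y * z)%g ;
  vmulDr : forall x y z : A, (x * (y + z))%g = (x * y)%g + (x * z)%g ;
  vmulZl : forall (a : R) (x y : A), ((a *: x) * y)%g = a *: (x * y)%g ;
  vmulZr : forall (a : R) (x y : A), (x * (a *: y))%g = a *: (x * y)%g ;
  vmul_ge0 : forall x y : A, vle 0 x -> vle 0 y -> vle 0 (x * y)%g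
}.

#[short(type="vectorLatticeAlgebraType")]
HB.structure Definition VectorLatticeAlgebra (R : realType) :=
  {A of VectorLattice R A & Semigroup A & VectorLattice_isAlgebra R A}.

HB.mixin Record VectorLatticeAlgebra_isFAlgebra (R : realType) A
    of VectorLatticeAlgebra R A := {
  vmul_meet0 : forall a b c : A, vmeet a b = 0 -> vle 0 c ->
    vmeet (a * c)%g b = 0 /\ vmeet (c * a)%g b = 0
}.

#[short(type="fAlgebraType")]
HB.structure Definition FAlgebra (R : realType) :=
  {A of VectorLatticeAlgebra R A & VectorLatticeAlgebra_isFAlgebra R A}.

HB.mixin Record FAlgebra_isBanach (R : realType) A
    of FAlgebra R A & CompleteNormedModule R A := {
  lattice_norm : forall x y : A, vle (labs x) (labs y) -> `|x| <= `|y| ;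
  norm_submultiplicative : forall x y : A, `|(x * y)%g| <= `|x| * `|y|
}.

#[short(type="banachFAlgebraType")]
HB.structure Definition BanachFAlgebra (R : realType) :=
  {A of FAlgebra R A & CompleteNormedModule R A & FAlgebra_isBanach R A}.

Definition semiprime (R : realType) (A : fAlgebraType R) : Prop :=
  forall a : A, (a * a)%g = 0 -> a = 0.

Definition lattice_algebra_hom (R : realType)
    (A B : vectorLatticeAlgebraType R) (h : A -> B) : Prop :=
  [/\ linear h,
      forall x y, h (vmeet x y) = vmeet (h x) (h y),
      forall x y, h (vjoin x y) = vjoin (h x) (h y)
    & forall x y, h (x * y)%g = (h x * h y)%g].

(* Extended-real valued, so that unbounded maps have norm [+oo]. *)
Definition opnorm (R : realType) (V W : normedModType R) (f : V -> W)
    : \bar R :=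
  ereal_sup [set `|f x|%:E | x in [set x : V | `|x| <= 1]].

Definition contractive (R : realType) (V W : normedModType R) (f : V -> W)
    : Prop := (opnorm f <= 1)%E.

(* Uniqueness of [h] is among all lattice-algebra homomorphisms extending [T];
   were it restricted to those of norm [opnorm T], every Banach f-algebra would
   be free over the zero space. *)
Definition is_FBfA (R : realType) (E : completeNormedModType R)
    (A : banachFAlgebraType R) (eta : E -> A) : Prop :=
  [/\ linear eta,
      forall x, `|eta x| = `|x|
    & forall (B : banachFAlgebraType R) (T : E -> B),
        linear T -> contractive T ->
        exists h : A -> B,
          [/\ lattice_algebra_hom h, h \o eta = T, opnorm h = opnorm T
            & forall g : A -> B,
                lattice_algebra_hom g -> g \o eta = T -> g = h]].

Definition is_induced_hom (R : realType) (E F : completeNormedModType R)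
    (FE FF : banachFAlgebraType R) (etaE : E -> FE) (etaF : F -> FF)
    (T : E -> F) (Tbar : FE -> FF) : Prop :=
  [/\ lattice_algebra_hom Tbar, opnorm Tbar = opnorm T
    & Tbar \o etaE = etaF \o T].

(* The norm of the class of [x] in the quotient of [V] by [N]. *)
Definition quotient_norm (R : realType) (V : normedModType R) (N : set V)
    (x : V) : R := inf [set `|x + n| | n in N].

(* For [T] linear, the map induced on the quotient by the kernel [T @^-1` [set 0]]
   sends the class of [x] to [T x]. *)
Definition quotient_map (R : realType) (V W : normedModType R) (T : V -> W)
    : Prop :=
  (forall y, exists x, T x = y) /\
  (forall x, `|T x| = quotient_norm (T @^-1` [set 0]) x).

(* The topological dual, as a set of functions on [E]. *)
Definition dual (R : realType) (E : normedModType R) : set (E -> R^o) :=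
  [set f | linear f /\ continuous f].

Definition dual_ball (R : realType) (E : normedModType R) : set (E -> R^o) :=
  [set f | dual f /\ (opnorm f <= 1)%E].

Definition adjoint (R : realType) (E F : normedModType R) (T : E -> F)
    (f : F -> R^o) : E -> R^o := f \o T.

(* The weak-star topology is the topology induced on the dual by the topology of
   pointwise convergence; the closure below is taken in the latter. *)
Definition weak_star_dense_in (R : realType) (E : normedModType R)
    (S B : set (E -> R^o)) : Prop :=
  B `<=` closure (S : set {ptws E -> R^o}).

(* Main.v *)
Require Import Defs.
From HB Require Import structures.
From mathcomp Require Import all_boot all_order all_algebra.
From mathcomp Require Import ring lra.
From mathcomp Require Import all_classical all_reals all_analysis.
Import Order.TTheory GRing.Theory Num.Theory.
Import numFieldNormedType.Exports.
Local Open Scope classical_set_scope.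
Local Open Scope ring_scope.

(** Everything is read off from the universal property of the free algebra.

The algebraic input is an estimate valid in every Banach f-algebra: if b and y
are positive and the norm of b is less than c, then b y <= c y
([vmul_le_norm]).  Thus multiplication by a fixed element is an operator bounded
in order by a multiple of the identity, and every order ideal is an algebra
ideal.

The range of the induced map is governed by two Banach f-algebras that live
inside FBfA[F]: the closure of the range with the inherited norm, and the range
itself with the quotient norm, the infimum of the norms of the preimages.  If
either one contains the image of F contractively, the universal property gives a
homomorphism from FBfA[F] into it, which must be the identity by uniqueness, so
that it fills FBfA[F] and its norm is at most the given one ([free_subalg]).
The first one shows that the induced map has dense range as soon as T has, the
second one that it is a quotient map as soon as T is.  Conversely, if the range
of T is not dense, the Hahn-Banach theorem provides a nonzero functional on F
that vanishes on it; its extension to FBfA[F] vanishes on the range of the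
induced map, by uniqueness again, and so that range is not dense.

A bijective lattice homomorphism between Banach f-algebras has a positive
inverse, and positive operators on a Banach lattice are bounded.  Hence if the
induced map is bijective it is bounded below, so T, which is its restriction to
E, is bounded below too; its range is dense by the above, and closed, hence
everything.

For the last part, the key is that both conditions force T to be isometric, in
the form: f x <= |T x| for every f in the unit ball of the dual of E.  This is
clear when the functionals g o T with g in the unit ball approximate f.  If the
induced map is injective and |T x| < c < f x, then b = |eta_F (T x)| satisfies
b b <= c b by the estimate above; the induced map is an injective lattice
homomorphism, so it reflects the order and a = |eta_E x| satisfies a a <= c a;
evaluating at f gives (f x)^2 <= c f x, a contradiction.  Once f x <= |T x| for
all x, the Hahn-Banach theorem shows that f is exactly g o T for some g in the
unit ball ([dual_ball_factor]), which is more than density.  Conversely, if every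
f factors in this way, then every contractive real-valued homomorphism on FBfA[E]
factors through the induced map by uniqueness, hence vanishes on its kernel; and
in a semiprime Banach f-algebra these homomorphisms separate the points
([exists_character]).  They are constructed as standard parts: if a a is not
zero, there are a prime order ideal P and d > 0 with a not in P and d a <= a a
modulo P; modulo P the algebra is totally ordered, and x a differs from a unique
real multiple of a by an infinitesimal multiple of a.  This real number is the
value at x, and it is at least d at a. *)

Set Implicit Arguments.
Unset Strict Implicit.
Unset Printing Implicit Defensive.

#[local] Arguments vle_trans {R s} [y x z].
#[local] Arguments vle_anti {R s} [x y].
#[local] Arguments vle_add2r {R s} z [x y].
#[local] Arguments vscale_ge0 {R s} [a x].
#[local] Arguments vmul_ge0 {R s} [x y].
#[local] Arguments vmul_meet0 {R s} [a b c].
#[local] Arguments lattice_norm {R s} [x y].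

(** * Vector lattices *)

Local Notation "x <=v y" := (vle x y) (at level 70, no associativity).

Definition vpos (R : realType) (V : vectorLatticeType R) (x : V) : V := vjoin x 0.

Section VectorLattice.
Context (R : realType) (V : vectorLatticeType R).
Implicit Types (x y z t u v w : V) (a : R).

Lemma vle_joinl x y : x <=v vjoin x y.
Proof. by have /vjoin_le[] := vle_refl (vjoin x y). Qed.

Lemma vle_joinr x y : y <=v vjoin x y.
Proof. by have /vjoin_le[] := vle_refl (vjoin x y). Qed.

Lemma vmeet_lel x y : vmeet x y <=v x.
Proof. by have /vle_meet[] := vle_refl (vmeet x y). Qed.

Lemma vmeet_ler x y : vmeet x y <=v y.
Proof. by have /vle_meet[] := vle_refl (vmeet x y). Qed.

Lemma vmeetC x y : vmeet x y = vmeet y x.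
Proof.
by apply: vle_anti; apply/vle_meet; split; rewrite ?vmeet_lel ?vmeet_ler//;
  [exact: vmeet_ler|exact: vmeet_lel|exact: vmeet_ler|exact: vmeet_lel].
Qed.

Lemma vle_addl z x y : x <=v y -> z + x <=v z + y.
Proof. by rewrite ![z + _]addrC; exact: vle_add2r. Qed.

Lemma vle_add x y z t : x <=v y -> z <=v t -> x + z <=v y + t.
Proof. by move=> xy zt; apply: (vle_trans (vle_add2r z xy)); exact: vle_addl. Qed.

Lemma vsubr_ge0 x y : 0 <=v y - x <-> x <=v y.
Proof.
split=> [/(vle_add2r x)|/(vle_add2r (- x))]; first by rewrite add0r subrK.
by rewrite subrr.
Qed.

Lemma vle_subl x y z : x - z <=v y <-> x <=v y + z.
Proof. by split=> [/(vle_add2r z)|/(vle_add2r (- z))]; rewrite ?subrK ?addrK. Qed.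

Lemma vle_opp x y : x <=v y -> - y <=v - x.
Proof. by move=> /vsubr_ge0 xy; apply/vsubr_ge0; rewrite opprK addrC. Qed.

Lemma vaddr_ge0 x y : 0 <=v x -> 0 <=v y -> 0 <=v x + y.
Proof. by move=> x0 y0; rewrite -[0]addr0; exact: vle_add. Qed.

Lemma vle_addr_ge0 x y : 0 <=v y -> x <=v x + y.
Proof. by move=> y0; rewrite -{1}[x]addr0; exact: vle_addl. Qed.

Lemma vle_scale a x y : 0 <= a -> x <=v y -> a *: x <=v a *: y.
Proof.
move=> a0 /vsubr_ge0 xy; apply/vsubr_ge0; rewrite -scalerBr; exact: vscale_ge0.
Qed.

Lemma vle_scaler a b x : a <= b -> 0 <=v x -> a *: x <=v b *: x.
Proof.
move=> ab x0; apply/vsubr_ge0; rewrite -scalerBl; apply: vscale_ge0 => //.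
by rewrite subr_ge0.
Qed.

Lemma vjoinD x y z : vjoin x y + z = vjoin (x + z) (y + z).
Proof.
apply: vle_anti; last first.
  apply/vjoin_le; split; apply: vle_add2r; [exact: vle_joinl|exact: vle_joinr].
rewrite -[z in X in X <=v _]opprK; apply/vle_subl/vjoin_le; split.
  by rewrite -[x in X in X <=v _](addrK z); apply: vle_add2r; exact: vle_joinl.
by rewrite -[y in X in X <=v _](addrK z); apply: vle_add2r; exact: vle_joinr.
Qed.

Lemma vmeetE x y : vmeet x y = x + y - vjoin x y.
Proof.
apply: vle_anti; last first.
  apply/vle_meet; split; apply/vle_subl; [|rewrite addrC];
    apply: vle_addl; by [exact: vle_joinr|exact: vle_joinl].
rewrite -[vmeet x y](addrK (vjoin x y)); apply: vle_add2r.
rewrite addrC vjoinD; apply/vjoin_le; split; last rewrite [x + y]addrC.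
  by apply: vle_addl; exact: vmeet_ler.
by apply: vle_addl; exact: vmeet_lel.
Qed.

Lemma vmeet0_le_add x y z : vmeet x y = 0 -> 0 <=v z -> x <=v y + z -> x <=v z.
Proof.
move=> xy0 z0 xyz.
have : x - z <=v vmeet x y.
  apply/vle_meet; split; apply/vle_subl => //; exact: vle_addr_ge0.
by rewrite xy0 => /vle_subl; rewrite add0r.
Qed.

Lemma vmeet0_ge0 x y : vmeet x y = 0 -> 0 <=v x /\ 0 <=v y.
Proof. by move=> <-; split; [exact: vmeet_lel|exact: vmeet_ler]. Qed.

Lemma vmeet0P x y : 0 <=v x -> 0 <=v y ->
  (forall w, w <=v x -> w <=v y -> w <=v 0) -> vmeet x y = 0.
Proof.
move=> x0 y0 h; apply: vle_anti; last exact/vle_meet.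
by apply: h; [exact: vmeet_lel|exact: vmeet_ler].
Qed.

Lemma vmeet0S x y z : vmeet x y = 0 -> 0 <=v z -> z <=v y -> vmeet x z = 0.
Proof.
move=> xy0 z0 zy; have [x0 _] := vmeet0_ge0 xy0.
apply: vmeet0P => // w wx wz; rewrite -xy0; apply/vle_meet; split=> //.
exact: vle_trans zy.
Qed.

Lemma vmeet0D x y z : vmeet x y = 0 -> vmeet x z = 0 -> vmeet x (y + z) = 0.
Proof.
move=> xy0 xz0; have [x0 y0] := vmeet0_ge0 xy0; have [_ z0] := vmeet0_ge0 xz0.
apply: vmeet0P => //; first exact: vaddr_ge0.
move=> w wx wyz; rewrite -xz0; apply/vle_meet; split=> //.
have : w - z <=v vmeet x y.
  apply/vle_meet; split; apply/vle_subl => //.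
  by apply: (vle_trans wx); exact: vle_addr_ge0.
by rewrite xy0 => /vle_subl; rewrite add0r.
Qed.

Lemma vpos_ge0 x : 0 <=v vpos x. Proof. exact: vle_joinr. Qed.
Lemma vle_pos x : x <=v vpos x. Proof. exact: vle_joinl. Qed.

Lemma vpos_le x y : x <=v y -> 0 <=v y -> vpos x <=v y.
Proof. by move=> xy y0; apply/vjoin_le. Qed.

Lemma vpos_id x : 0 <=v x -> vpos x = x.
Proof.
move=> x0; apply: vle_anti; last exact: vle_pos.
by apply: vpos_le => //; exact: vle_refl.
Qed.

Lemma vpos_eq0 x : vpos x = 0 <-> x <=v 0.
Proof.
split=> [<-|x0]; first exact: vle_pos.
by apply: vle_anti (vpos_ge0 x); apply: vpos_le => //; exact: vle_refl.
Qed.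

Lemma vpos_mono x y : x <=v y -> vpos x <=v vpos y.
Proof.
by move=> xy; apply: vpos_le (vpos_ge0 _); exact: vle_trans (vle_pos _).
Qed.

Lemma vposD x y : vpos (x + y) <=v vpos x + vpos y.
Proof.
apply: vpos_le; first by apply: vle_add; exact: vle_pos.
by apply: vaddr_ge0; exact: vpos_ge0.
Qed.

Lemma vposN x : vpos (- x) = vpos x - x.
Proof.
rewrite /vpos vjoinD subrr add0r; apply: vle_anti; apply/vjoin_le; split;
  by [exact: vle_joinl|exact: vle_joinr].
Qed.

Lemma vposB x : vpos x - vpos (- x) = x.
Proof. by rewrite vposN opprB addrC subrK. Qed.

Lemma vpos_meet0 x : vmeet (vpos x) (vpos (- x)) = 0.
Proof.
have join0 : vjoin 0 (- x) = vpos (- x).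
  by apply: vle_anti; apply/vjoin_le; split; by [exact: vle_joinl|exact: vle_joinr].
rewrite vmeetE; suff -> : vjoin (vpos x) (vpos (- x)) = vpos x + vpos (- x).
  by rewrite subrr.
by rewrite {1}vposN -[X in vjoin X _]add0r [vpos x - x]addrC -vjoinD join0 addrC.
Qed.

Lemma vpos_sub u v : vmeet u v = 0 -> vpos (u - v) = u.
Proof.
move=> uv0; rewrite /vpos -[0](subrr v) -vjoinD.
have /eqP := vmeetE u v; rewrite uv0 eq_sym subr_eq0 => /eqP <-.
by rewrite addrK.
Qed.

Lemma vjoinE x y : vjoin x y = y + vpos (x - y).
Proof. by rewrite addrC /vpos vjoinD subrK add0r. Qed.

Lemma labs_le x y : labs x <=v y <-> x <=v y /\ - x <=v y.
Proof. exact: vjoin_le. Qed.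

Lemma vle_labs x : x <=v labs x. Proof. exact: vle_joinl. Qed.
Lemma vleN_labs x : - x <=v labs x. Proof. exact: vle_joinr. Qed.

Lemma labs_ge0 x : 0 <=v labs x.
Proof.
have /(@vscale_ge0 _ _ 2^-1) : 0 <=v labs x + labs x.
  by rewrite -(subrr x); exact: vle_add (vle_labs x) (vleN_labs x).
rewrite scalerDr -scalerDl (_ : 2^-1 + 2^-1 = 1) ?scale1r; last by lra.
by apply; rewrite invr_ge0.
Qed.

Lemma labs_id x : 0 <=v x -> labs x = x.
Proof.
move=> x0; apply: vle_anti (vle_labs x); apply/labs_le; split; first exact: vle_refl.
by apply: (vle_trans _ x0); rewrite -oppr0; exact: vle_opp.
Qed.

Lemma labsN x : labs (- x) = labs x.
Proof.
by apply: vle_anti; apply/labs_le; rewrite ?opprK; split;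
  rewrite -?[- - x]opprK; do ?[exact: vle_labs|exact: vleN_labs];
  rewrite -{1}[x]opprK; exact: vleN_labs.
Qed.

Lemma labsD x y : labs (x + y) <=v labs x + labs y.
Proof.
apply/labs_le; split; rewrite ?opprD; apply: vle_add;
  by [exact: vle_labs|exact: vleN_labs].
Qed.

Lemma labs_pos x : labs x = vpos x + vpos x - x.
Proof.
rewrite -addrA -vposN; apply: vle_anti.
  apply/labs_le; split; last rewrite addrC.
    exact: vle_trans (vle_pos x) (vle_addr_ge0 _ (vpos_ge0 _)).
  exact: vle_trans (vle_pos (- x)) (vle_addr_ge0 _ (vpos_ge0 _)).
have -> : vpos x + vpos (- x) = vjoin (vpos x) (vpos (- x)).
  have /eqP := vmeetE (vpos x) (vpos (- x)).
  by rewrite vpos_meet0 eq_sym subr_eq0 => /eqP.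
by apply/vjoin_le; split; apply: vpos_le (labs_ge0 x); [exact: vle_labs|exact: vleN_labs].
Qed.

Lemma labsE x : labs x = vpos x + vpos (- x).
Proof. by rewrite labs_pos vposN addrA. Qed.

Lemma vpos_labs x : vpos x = 2^-1 *: (x + labs x).
Proof.
by rewrite labs_pos addrC subrK scalerDr -scalerDl (_ : 2^-1 + 2^-1 = 1) ?scale1r//; lra.
Qed.

Lemma labsZ_le a x : labs (a *: x) <=v `|a| *: labs x.
Proof.
have [a0|/ltW a0] := leP 0 a.
  rewrite ger0_norm//; apply/labs_le; rewrite -scalerN; split;
  apply: vle_scale => //; by [exact: vle_labs|exact: vleN_labs].
rewrite ler0_norm//; apply/labs_le; split; last first.
  by rewrite -scaleNr; apply: vle_scale; rewrite ?oppr_ge0//; exact: vle_labs.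
rewrite -[a in X in X <=v _]opprK scaleNr -scalerN.
by apply: vle_scale; rewrite ?oppr_ge0//; exact: vleN_labs.
Qed.

Lemma labsB_labs x y : labs (labs x - labs y) <=v labs (x - y).
Proof.
apply/labs_le; split; rewrite ?opprB; apply/vle_subl.
  by rewrite -{1}[x](subrK y); exact: labsD.
by rewrite -{1}[y](subrK x) -[labs (x - y)]labsN opprB; exact: labsD.
Qed.

End VectorLattice.

(** * f-algebras and Banach f-algebras *)

Section FAlgebraTheory.
Context (R : realType) (A : fAlgebraType R).
Implicit Types x y z a b : A.

Lemma vmul0l x : (0 * x)%g = 0.
Proof. by rewrite -[X in (X * _)%g](scale0r (0 : A)) vmulZl scale0r. Qed.

Lemma vmulNl x y : (- x * y)%g = - (x * y)%g.
Proof. by rewrite -scaleN1r vmulZl scaleN1r. Qed.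

Lemma vmulNr x y : (x * - y)%g = - (x * y)%g.
Proof. by rewrite -scaleN1r vmulZr scaleN1r. Qed.

Lemma vmulBl x y z : ((x - y) * z)%g = (x * z)%g - (y * z)%g.
Proof. by rewrite vmulDl vmulNl. Qed.

Lemma vmulBr x y z : (x * (y - z))%g = (x * y)%g - (x * z)%g.
Proof. by rewrite vmulDr vmulNr. Qed.

(** The f-algebra axiom makes the images of the positive and negative parts of
    [x] disjoint, and a difference of disjoint elements has only one
    decomposition of this kind. *)
Lemma vmul_posl a x : 0 <=v a -> vpos (a * x)%g = (a * vpos x)%g.
Proof.
move=> a0; rewrite -{1}(vposB x) vmulBr; apply: vpos_sub.
have [_ ax] := vmul_meet0 (vpos_meet0 x) a0.
by rewrite vmeetC in ax; have [_ +] := vmul_meet0 ax a0; rewrite vmeetC.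
Qed.

Lemma vmul_posr a x : 0 <=v a -> vpos (x * a)%g = (vpos x * a)%g.
Proof.
move=> a0; rewrite -{1}(vposB x) vmulBl; apply: vpos_sub.
have [ax _] := vmul_meet0 (vpos_meet0 x) a0.
by rewrite vmeetC in ax; have [+ _] := vmul_meet0 ax a0; rewrite vmeetC.
Qed.

Lemma labs_mull a x : 0 <=v a -> labs (a * x)%g = (a * labs x)%g.
Proof. by move=> a0; rewrite !labsE -vmulNr !vmul_posl// vmulDr. Qed.

Lemma labs_mulr a x : 0 <=v a -> labs (x * a)%g = (labs x * a)%g.
Proof. by move=> a0; rewrite !labsE -vmulNl !vmul_posr// vmulDl. Qed.

Lemma labs_mul x y : labs (x * y)%g <=v (labs x * labs y)%g.
Proof.
rewrite -{1}(vposB x) vmulBl; apply: (vle_trans (labsD _ _)).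
rewrite labsN !labs_mull; [|exact: vpos_ge0..].
by rewrite -vmulDl -labsE; exact: vle_refl.
Qed.

End FAlgebraTheory.

Lemma exists_expr_le (R : realType) (t e : R) : 0 <= t -> t < 1 -> 0 < e ->
  exists n, t ^+ n <= e.
Proof.
move=> t0 t1 e0.
have /cvgrPdist_le /(_ _ e0) [n _ /(_ n (leqnn _))] : t ^+ n @[n --> \oo] --> 0.
  by apply: cvg_expr; rewrite ger0_norm.
rewrite sub0r normrN ger0_norm ?exprn_ge0// => ?; by exists n.
Qed.

Section BanachFAlgebraTheory.
Context (R : realType) (A : banachFAlgebraType R).
Implicit Types x y z a b : A.

Lemma norm_labs x : `|labs x| = `|x|.
Proof.
by apply: le_anti; rewrite !lattice_norm// [labs (labs x)]labs_id;
  [exact: vle_refl|exact: labs_ge0|exact: vle_refl|exact: labs_ge0].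
Qed.

Lemma vle_norm x y : 0 <=v x -> x <=v y -> `|x| <= `|y|.
Proof.
move=> x0 xy; apply: lattice_norm; rewrite !labs_id//; exact: vle_trans xy.
Qed.

Lemma vle_norm_labs x y : labs x <=v y -> `|x| <= `|y|.
Proof. by move=> xy; rewrite -norm_labs; apply: vle_norm xy; exact: labs_ge0. Qed.

Lemma norm_vpos x : `|vpos x| <= `|x|.
Proof.
rewrite -[leRHS]norm_labs; apply: vle_norm (vpos_ge0 _) _.
by apply: vpos_le (labs_ge0 _); exact: vle_labs.
Qed.

(** The positive part of [x] lies below the positive part of each such [y], so
    it has norm zero.  This is how limits are taken in inequalities. *)
Lemma vle0_norm_small x :
  (forall e : R, 0 < e -> exists2 y, `|y| <= e & x <=v y) -> x <=v 0.
Proof.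
move=> small; apply/vpos_eq0/normr0_eq0/le_anti; rewrite normr_ge0 andbT.
apply/ler_addgt0Pr => e e0; rewrite add0r.
have [y ye xy] := small e e0; apply: le_trans ye.
apply: le_trans (norm_vpos y); apply: vle_norm (vpos_ge0 _) _.
exact: vpos_mono.
Qed.

Lemma vge0_norm_small x :
  (forall e : R, 0 < e -> exists2 y, `|x - y| <= e & 0 <=v y) -> 0 <=v x.
Proof.
move=> small; rewrite -[x]opprK -oppr0; apply: vle_opp.
apply: vle0_norm_small => e e0; have [y xy y0] := small e e0.
exists (y - x); first by rewrite distrC.
by rewrite -[X in X <=v _]add0r; exact: vle_add2r.
Qed.

Lemma norm_iter_mul b y n : `|iter n (fun z => (b * z)%g) y| <= `|b| ^+ n * `|y|.
Proof.
elim: n => [|n IHn] /=; first by rewrite expr0 mul1r.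
rewrite (le_trans (norm_submultiplicative _ _))// exprS -mulrA.
by rewrite ler_wpM2l.
Qed.

(** With L the multiplication by [b], the elements (b y - y)^+ and
    (b y - L^n (b y))^+ are disjoint: b y - L^n (b y) is the negative of the sum
    of the L^k (b y - y) for 0 < k <= n, and applying a power of L to
    (b y - y)^- keeps it disjoint from (b y - y)^+.  As (b y - y)^+ is at most
    b y, which is the sum of b y - L^n (b y) and L^n (b y), it is at most
    L^n (b y), and this tends to zero. *)
Lemma vmul_le_of_norm_lt1 b y : 0 <=v b -> 0 <=v y -> `|b| < 1 ->
  (b * y)%g <=v y.
Proof.
move=> b0 y0 b1.
pose L := fun z => (b * z)%g; pose w := (b * y)%g - y.
pose u n := iter n L (b * y)%g - (b * y)%g.
have disj n : vmeet (vpos w) (vpos (- u n)) = 0.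
  elim: n => [|n IHn].
    rewrite /u /= subrr oppr0 [vpos 0]vpos_id; last exact: vle_refl.
    apply: vmeet0P; [exact: vpos_ge0|exact: vle_refl|by []].
  have uS : - u n.+1 = (b * (- u n))%g + (b * (- w))%g.
    rewrite /u /w /= /L !opprB !vmulBr.
    by rewrite [RHS]addrC subrKA.
  rewrite uS; apply: (@vmeet0S _ _ _ (_ + _)); last exact: vposD.
    2: exact: vpos_ge0.
  rewrite !vmul_posl//; apply: vmeet0D.
    by rewrite vmeetC in IHn; have [_ +] := vmul_meet0 IHn b0; rewrite vmeetC.
  have := vpos_meet0 w; rewrite vmeetC => ww.
  by have [_ +] := vmul_meet0 ww b0; rewrite vmeetC.
apply/vsubr_ge0; rewrite -[y - _]opprB -/w -oppr0; apply: vle_opp.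
apply: vle0_norm_small => e e0.
have by0 : 0 < `|(b * y)%g| + 1 by rewrite ltr_wpDl.
have [n hn] := exists_expr_le (normr_ge0 b) b1 (divr_gt0 e0 by0).
exists (iter n L (b * y)%g).
  rewrite (le_trans (norm_iter_mul _ _ _))//.
  rewrite (le_trans (ler_wpM2r (normr_ge0 _) hn))// -mulrA ger_pMr//.
  by rewrite mulrC ler_pdivrMr// mul1r lerDl.
apply: vle_trans (vle_pos w) _; apply: vmeet0_le_add (disj n) _ _.
  elim: (n) => /= [|k IHk]; first exact: vmul_ge0.
  exact: vmul_ge0.
apply: (@vle_trans _ _ (b * y)%g).
  apply: vpos_le; last exact: vmul_ge0.
  by rewrite -[X in _ <=v X]subr0; apply: vle_addl; exact: vle_opp.
rewrite -[X in X <=v _](subrK (iter n L (b * y)%g)); apply: vle_add2r.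
by apply: vle_trans (vle_pos _); rewrite opprB; exact: vle_refl.
Qed.

(** Multiplication operators are thus bounded by multiples of the identity: they
    lie in the centre of the lattice. *)
Lemma vmul_le_norm b y c : 0 <=v b -> 0 <=v y -> `|b| < c -> (b * y)%g <=v c *: y.
Proof.
move=> b0 y0 bc; have c0 : 0 < c by apply: le_lt_trans bc.
have := @vmul_le_of_norm_lt1 (c^-1 *: b) y.
rewrite normrZ gtr0_norm ?invr_gt0// mulrC ltr_pdivrMr// mul1r.
have c10 : 0 <= c^-1 by rewrite invr_ge0 ltW.
move=> /(_ (vscale_ge0 c10 b0) y0 bc) /(vle_scale (ltW c0)).
by rewrite vmulZl scalerA divff ?scale1r// gt_eqF.
Qed.

End BanachFAlgebraTheory.

(** * Linear maps and lattice-algebra homomorphisms *)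

Section LinearMaps.
Context (R : realType) (U V : lmodType R) (f : U -> V) (f_lin : linear f).

Lemma lin0 : f 0 = 0.
Proof. by rewrite -{1}(addNr (0 : U)) -scaleN1r f_lin scaleN1r addNr. Qed.

Lemma linD x y : f (x + y) = f x + f y.
Proof. by rewrite -{1}[x]scale1r f_lin scale1r. Qed.

Lemma linZ a x : f (a *: x) = a *: f x.
Proof. by rewrite -{1}[a *: x]addr0 f_lin lin0 addr0. Qed.

Lemma linN x : f (- x) = - f x.
Proof. by rewrite -scaleN1r linZ scaleN1r. Qed.

Lemma linB x y : f (x - y) = f x - f y.
Proof. by rewrite linD linN. Qed.

End LinearMaps.

(** Meet and join are linear expressions in [x], [y] and the modulus of [x - y]. *)
Lemma lattice_hom_of_labs (R : realType) (U V : vectorLatticeType R)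
    (f : U -> V) : linear f -> (forall x, f (labs x) = labs (f x)) ->
  (forall x y, f (vmeet x y) = vmeet (f x) (f y)) /\
  (forall x y, f (vjoin x y) = vjoin (f x) (f y)).
Proof.
move=> f_lin f_labs.
have f_join x y : f (vjoin x y) = vjoin (f x) (f y).
  rewrite !vjoinE !vpos_labs (linD f_lin) (linZ f_lin) (linD f_lin).
  by rewrite f_labs (linB f_lin).
by split=> // x y; rewrite !vmeetE (linB f_lin) (linD f_lin) f_join.
Qed.

Section Homomorphisms.
Context (R : realType).

Lemma contractiveP (V W : normedModType R) (f : V -> W) : linear f ->
  (contractive f <-> forall x, `|f x| <= `|x|).
Proof.
move=> f_lin; split=> [f_le x|f_le].
  have [->|x0] := eqVneq x 0; first by rewrite (lin0 f_lin) !normr0.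
  have nx : 0 < `|x| by rewrite normr_gt0.
  have : (`|f (`|x|^-1 *: x)|%:E <= 1)%E.
    apply: le_trans f_le; apply: ereal_sup_ubound; exists (`|x|^-1 *: x) => //=.
    by rewrite normrZ normfV normr_id mulVf ?gt_eqF.
  by rewrite (linZ f_lin) normrZ normfV normr_id lee_fin ler_pdivrMl// mulr1.
apply: ge_ereal_sup => _ /= [x x1 <-]; rewrite lee_fin.
exact: le_trans (f_le x) x1.
Qed.

Lemma lattice_algebra_hom_comp (A B C : vectorLatticeAlgebraType R)
    (g : B -> C) (f : A -> B) :
  lattice_algebra_hom g -> lattice_algebra_hom f -> lattice_algebra_hom (g \o f).
Proof.
move=> [g1 g2 g3 g4] [f1 f2 f3 f4]; split=> [a x y|x y|x y|x y] /=.
- by rewrite f1 g1.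
- by rewrite f2 g2.
- by rewrite f3 g3.
- by rewrite f4 g4.
Qed.

Lemma hom_labs (A B : vectorLatticeAlgebraType R) (f : A -> B) x :
  lattice_algebra_hom f -> f (labs x) = labs (f x).
Proof. by move=> [f1 _ f3 _]; rewrite /labs f3 (linN f1). Qed.

Lemma hom_pos (A B : vectorLatticeAlgebraType R) (f : A -> B) x :
  lattice_algebra_hom f -> f (vpos x) = vpos (f x).
Proof. by move=> [f1 _ f3 _]; rewrite /vpos f3 (lin0 f1). Qed.

End Homomorphisms.

Lemma hom_le (R : realType) (A B : vectorLatticeAlgebraType R) (g : A -> B) x y :
  lattice_algebra_hom g -> x <=v y -> g x <=v g y.
Proof.
move=> g_hom; have [g_lin _ _ _] := g_hom.
move=> xy; suff /vpos_eq0 /vle_subl : vpos (g x - g y) = 0 by rewrite add0r.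
rewrite -(linB g_lin) -(hom_pos _ g_hom) (_ : vpos _ = 0) ?(lin0 g_lin)//.
by apply/vpos_eq0/vle_subl; rewrite add0r.
Qed.

(** An inequality says that a positive part vanishes, which an injective
    homomorphism detects. *)
Lemma injective_hom_le (R : realType) (A B : vectorLatticeAlgebraType R)
    (g : A -> B) x y : lattice_algebra_hom g -> injective g ->
  g x <=v g y -> x <=v y.
Proof.
move=> g_hom g_inj gxy; have [g_lin _ _ _] := g_hom.
suff : vpos (x - y) = 0 by move=> /vpos_eq0 /vle_subl; rewrite add0r.
apply: g_inj; rewrite (hom_pos _ g_hom) (linB g_lin) (lin0 g_lin).
by apply/vpos_eq0/vle_subl; rewrite add0r.
Qed.

(** * Prime ideals and real-valued homomorphisms *)

Section Scalars.
Variable R : realType.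
Local Notation V := (R^o).
Implicit Types x y z : V.

Let scalar_le (x y : V) : Prop := (x : R) <= y.
Let scalar_min (x y : V) : V := Num.min (x : R) y.
Let scalar_max (x y : V) : V := Num.max (x : R) y.

Fact scalar_le_refl x : scalar_le x x.
Proof. exact: lexx. Qed.

Fact scalar_le_anti x y : scalar_le x y -> scalar_le y x -> x = y.
Proof. by move=> xy yx; apply/eqP; rewrite eq_le; apply/andP. Qed.

Fact scalar_le_trans y x z : scalar_le x y -> scalar_le y z -> scalar_le x z.
Proof. exact: le_trans. Qed.

Fact scalar_le_min x y z :
  scalar_le z (scalar_min x y) <-> scalar_le z x /\ scalar_le z y.
Proof. by rewrite /scalar_le /scalar_min le_min; split => /andP. Qed.

Fact scalar_max_le x y z :
  scalar_le (scalar_max x y) z <-> scalar_le x z /\ scalar_le y z.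
Proof. by rewrite /scalar_le /scalar_max ge_max; split => /andP. Qed.

Fact scalar_le_add2r z x y : scalar_le x y -> scalar_le (x + z) (y + z).
Proof. by rewrite /scalar_le lerD2r. Qed.

Fact scalar_scale_ge0 (a : R) x : 0 <= a -> scalar_le 0 x -> scalar_le 0 (a *: x).
Proof. exact: mulr_ge0. Qed.

HB.instance Definition _ := Lmodule_isVectorLattice.Build R V
  scalar_le_refl scalar_le_anti scalar_le_trans scalar_le_min scalar_max_le
  scalar_le_add2r scalar_scale_ge0.

HB.instance Definition _ := isSemigroup.Build V (@mulrA R).

Fact scalar_mulDl x y z : ((x + y) * z)%g = (x * z)%g + (y * z)%g.
Proof. exact: mulrDl. Qed.

Fact scalar_mulDr x y z : (x * (y + z))%g = (x * y)%g + (x * z)%g.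
Proof. exact: mulrDr. Qed.

Fact scalar_mulZl (a : R) x y : ((a *: x) * y)%g = a *: (x * y)%g.
Proof. by rewrite /GRing.scale /= mulrA. Qed.

Fact scalar_mulZr (a : R) x y : (x * (a *: y))%g = a *: (x * y)%g.
Proof. exact: mulrCA. Qed.

Fact scalar_mul_ge0 x y : vle 0 x -> vle 0 y -> vle 0 (x * y)%g.
Proof. exact: mulr_ge0. Qed.

HB.instance Definition _ := VectorLattice_isAlgebra.Build R V
  scalar_mulDl scalar_mulDr scalar_mulZl scalar_mulZr scalar_mul_ge0.

Fact scalar_mul_min0 (a b c : V) : vmeet a b = 0 -> vle 0 c ->
  vmeet (a * c)%g b = 0 /\ vmeet (c * a)%g b = 0.
Proof.
rewrite /vmeet/= /vle/= /scalar_min /scalar_le => ab c0.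
have -> : (c * a)%g = (a * c)%g by exact: mulrC.
suff -> : Num.min (a * c)%g b = 0 by [].
have a0 : 0 <= (a : R) by rewrite -ab ge_min lexx.
have b0 : 0 <= (b : R) by rewrite -ab ge_min lexx orbT.
have ac0 : 0 <= (a * c)%g :> R by exact: mulr_ge0.
have [ale|blt] := leP (a : R) b.
  have -> : a = 0 by rewrite -ab min_l.
  by rewrite [(0 * c)%g]mul0r min_l.
have -> : b = 0 by rewrite -ab min_r// ltW.
by rewrite min_r.
Qed.

HB.instance Definition _ :=
  VectorLatticeAlgebra_isFAlgebra.Build R V scalar_mul_min0.

Lemma labs_scalar x : labs x = `|x|.
Proof. exact: maxrN. Qed.

Fact scalar_lattice_norm x y : vle (labs x) (labs y) -> `|x| <= `|y|.
Proof. by rewrite !labs_scalar. Qed.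

Fact scalar_normM x y : `|(x * y)%g| <= `|x| * `|y|.
Proof. by rewrite [leLHS]normrM. Qed.

HB.instance Definition _ :=
  FAlgebra_isBanach.Build R V scalar_lattice_norm scalar_normM.

End Scalars.

(** An order ideal, represented by its positive cone. *)
Definition positive_ideal (R : realType) (V : vectorLatticeType R)
    (P : set V) : Prop :=
  [/\ P 0, forall x, P x -> 0 <=v x,
      forall x y, P x -> P y -> P (x + y)
    & forall x y, P x -> 0 <=v y -> y <=v x -> P y].

(** The positive cone of the order ideal generated by [P] and the positive
    element [z]. *)
Definition adjoin (R : realType) (V : vectorLatticeType R) (P : set V) (z : V)
    : set V :=
  [set w | 0 <=v w /\ exists2 p, P p & exists n, w <=v p + z *+ n].

Section PrimeIdeals.
Context (R : realType) (V : vectorLatticeType R).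
Implicit Types (P I : set V) (x y z a : V).

Lemma vmeet0Mn x y n : vmeet x y = 0 -> vmeet x (y *+ n) = 0.
Proof.
move=> xy0; have [x0 _] := vmeet0_ge0 xy0; elim: n => [|n IHn].
  by rewrite mulr0n; apply: vmeet0P; rewrite //; exact: vle_refl.
by rewrite mulrS; exact: vmeet0D.
Qed.

Lemma positive_ideal0 : positive_ideal [set 0 : V].
Proof.
split=> [//|x ->|x y -> ->|x y -> y0 y0']; [exact: vle_refl|exact: addr0|].
exact: vle_anti.
Qed.

Lemma adjoin_ideal P z : positive_ideal P -> 0 <=v z -> positive_ideal (adjoin P z).
Proof.
move=> [P0 Pge0 PD PS] z0; split.
- split; first exact: vle_refl.
  by exists 0 => //; exists 0%N; rewrite mulr0n addr0; exact: vle_refl.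
- by move=> x [].
- move=> x y [x0 [p Pp [n xpn]]] [y0 [q Pq [m yqm]]]; split; first exact: vaddr_ge0.
  exists (p + q); first exact: PD.
  by exists (n + m)%N; rewrite mulrnDr addrACA; exact: vle_add.
- move=> x y [x0 [p Pp [n xpn]]] y0 yx; split=> //.
  by exists p => //; exists n; exact: vle_trans xpn.
Qed.

Lemma subset_adjoin P z : positive_ideal P -> P `<=` adjoin P z.
Proof.
move=> [P0 Pge0 PD PS] x Px; split; first exact: Pge0.
by exists x => //; exists 0%N; rewrite mulr0n addr0; exact: vle_refl.
Qed.

Lemma mem_adjoin P z : positive_ideal P -> 0 <=v z -> adjoin P z z.
Proof.
move=> [P0 Pge0 PD PS] z0; split=> //.
by exists 0 => //; exists 1%N; rewrite mulr1n add0r; exact: vle_refl.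
Qed.

(** An ideal that is maximal among those avoiding [a] is prime: if neither of
    the disjoint elements [x] and [y] belonged to it, then [a] would lie below
    p + n x and q + m y with p and q in the ideal, hence below p + q. *)
Lemma exists_prime_ideal I a : positive_ideal I -> ~ I a ->
  exists P, [/\ positive_ideal P, I `<=` P, ~ P a
    & forall x y, vmeet x y = 0 -> P x \/ P y].
Proof.
move=> I_ideal nIa.
(* Taking the union with I lets the empty chain have the upper bound I. *)
pose Q P := positive_ideal (I `|` P) /\ ~ (I `|` P) a.
have [|P [[P_ideal nPa] P_max]] := @Zorn_bigcup V Q.
  move=> F FQ F_tot; split; last first.
    by move=> [//|[X FX Xa]]; have [_] := FQ _ FX; apply; right.
  have [I0 Ige0 ID IS] := I_ideal.
  split.
  - by left.
  - move=> x [/Ige0//|[X FX Xx]]; have [[_ + _ _] _] := FQ _ FX; apply.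
    by right.
  - have aux X x y : F X -> (I `|` X) x -> (I `|` X) y ->
        (I `|` \bigcup_(X in F) X) (x + y).
      move=> FX Xx Xy; have [[_ _ + _] _] := FQ _ FX.
      by move=> /(_ _ _ Xx Xy) [|xy]; [left|right; exists X].
    move=> x y [Ix|[X FX Xx]] [Iy|[Y FY Yy]].
    + by left; exact: ID.
    + by apply: (aux Y) => //; [left|right].
    + by apply: (aux X) => //; [right|left].
    + have [XY|YX] := F_tot _ _ FX FY.
        by apply: (aux Y) => //; right => //; exact: XY.
      by apply: (aux X) => //; right => //; exact: YX.
  - move=> x y [Ix|[X FX Xx]] y0 yx; first by left; exact: IS yx.
    have [[_ _ _ XS] _] := FQ _ FX.
    have [|Iy|Xy] := XS x y _ y0 yx; first by right.
      by left.
    by right; exists X.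
exists (I `|` P); split=> //.
move=> x y xy0; have [x0 y0] := vmeet0_ge0 xy0.
have key z : 0 <=v z -> (I `|` P) z \/ adjoin (I `|` P) z a.
  move=> z0; have [|nPz] := pselect ((I `|` P) z); first by left.
  right; apply: contrapT => nza.
  apply: (P_max (adjoin (I `|` P) z)).
    split; first by move=> w Pw; apply: subset_adjoin => //; right.
    by move=> /(_ z (mem_adjoin P_ideal z0)) Pz; apply: nPz; right.
  have -> : Q (adjoin (I `|` P) z) =
      (positive_ideal (adjoin (I `|` P) z) /\ ~ adjoin (I `|` P) z a).
    rewrite /Q (_ : I `|` _ = adjoin (I `|` P) z)//; apply/setUidPr.
    by move=> w Iw; apply: subset_adjoin => //; left.
  by split=> //; exact: adjoin_ideal.
have [|[a0 [p Pp [n apn]]]] := key x x0; first by left.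
have [|[_ [q Pq [m aqm]]]] := key y y0; first by right.
have [P0 Pge0 PD PS] := P_ideal.
exfalso; apply: nPa; apply: (PS (p + q)) => //; first exact: PD.
have p0 := Pge0 _ Pp; have q0 := Pge0 _ Pq.
have : a - (p + q) <=v vmeet (x *+ n) (y *+ m).
  apply/vle_meet; split; apply/vle_subl; rewrite addrC.
    apply: (vle_trans apn); apply: vle_add2r; exact: vle_addr_ge0.
  apply: (vle_trans aqm); apply: vle_add2r; rewrite addrC; exact: vle_addr_ge0.
rewrite vmeet0Mn; first by move=> /vle_subl; rewrite add0r.
by rewrite vmeetC; apply: vmeet0Mn; rewrite vmeetC.
Qed.

End PrimeIdeals.

Section StandardPart.
Context (R : realType) (A : banachFAlgebraType R) (a : A) (P : set A).
Hypotheses (a_ge0 : 0 <=v a) (P_ideal : positive_ideal P) (nPa : ~ P a).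
Hypothesis P_prime : forall x y, vmeet x y = 0 -> P x \/ P y.
Implicit Types (x y z w : A) (r s t e c : R).

Let P0 : P 0. Proof. by case: P_ideal. Qed.
Let Pge0 x : P x -> 0 <=v x. Proof. by case: P_ideal => _ + _ _; apply. Qed.
Let PD x y : P x -> P y -> P (x + y). Proof. by case: P_ideal => _ _ + _; apply. Qed.
Let PS x y : P x -> 0 <=v y -> y <=v x -> P y.
Proof. by case: P_ideal => _ _ _; apply. Qed.

Let PZ t x : 0 <= t -> P x -> P (t *: x).
Proof.
move=> t0 Px; have x0 := Pge0 Px.
have PMn n : P (x *+ n).
  by elim: n => [|n IHn]; rewrite ?mulr0n// mulrS; exact: PD.
apply: (PS (PMn (Num.bound t))); first exact: vscale_ge0.
by rewrite -scaler_nat; apply: vle_scaler => //; exact/ltW/archi_boundP.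
Qed.

(** The relation x <= 0 in the quotient by the ideal. *)
Let neg x := P (vpos x).

Let neg_le x y : x <=v y -> neg y -> neg x.
Proof. by move=> xy ny; apply: (PS ny (vpos_ge0 _)); exact: vpos_mono. Qed.

Let negD x y : neg x -> neg y -> neg (x + y).
Proof. by move=> nx ny; apply: (PS (PD nx ny) (vpos_ge0 _)); exact: vposD. Qed.

Let neg_total x : neg x \/ neg (- x).
Proof. exact/P_prime/vpos_meet0. Qed.

Let neg_le0 x : x <=v 0 -> neg x.
Proof. by move=> /vpos_eq0; rewrite /neg => ->. Qed.

Let neg_mul x w : 0 <=v x -> neg w -> neg (x * w)%g.
Proof.
move=> x0 nw; rewrite /neg vmul_posl//.
have c0 : `|x| < `|x| + 1 by rewrite ltrDl.
apply: (PS (PZ _ nw)); last exact: (vmul_le_norm x0 (vpos_ge0 w) c0).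
  by rewrite addr_ge0.
by apply: vmul_ge0 => //; exact: vpos_ge0.
Qed.

Let negZ t w : 0 <= t -> neg w -> neg (t *: w).
Proof.
move=> t0 nw; apply: (PS (PZ t0 nw) (vpos_ge0 _)); apply: vpos_le.
  by apply: vle_scale => //; exact: vle_pos.
by apply: vscale_ge0 => //; exact: vpos_ge0.
Qed.

Let neg_scale_a t : neg (t *: a) -> t <= 0.
Proof.
move=> nta; rewrite leNgt; apply/negP => t0; apply: nPa.
have := @PZ t^-1 _ _ nta; rewrite vpos_id ?scalerA ?mulVf ?gt_eqF ?scale1r//.
  by apply; rewrite invr_ge0 ltW.
by apply: vscale_ge0 => //; exact: ltW.
Qed.

Let neg_labs z w : neg (z - w) -> neg (- z - w) -> neg (labs z - w).
Proof.
move=> n1 n2; apply: (PS (PD n1 n2) (vpos_ge0 _)); apply: vpos_le; last first.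
  by apply: vaddr_ge0; exact: vpos_ge0.
apply/vle_subl/labs_le; split; apply/vle_subl; apply: (vle_trans (vle_pos _)).
  by apply: vle_addr_ge0; exact: vpos_ge0.
by rewrite [X in _ <=v X]addrC; apply: vle_addr_ge0; exact: vpos_ge0.
Qed.

(** In the quotient by the ideal, [z] is smaller in modulus than every positive
    multiple of [a]. *)
Definition infinitesimal z := forall e, 0 < e -> neg (labs z - e *: a).

Let inf_solid z w : labs z <=v labs w -> infinitesimal w -> infinitesimal z.
Proof. by move=> zw iw e e0; apply: neg_le (iw e e0); exact: vle_add2r. Qed.

Let infD z w : infinitesimal z -> infinitesimal w -> infinitesimal (z + w).
Proof.
move=> iz iw e e0; have e20 : 0 < e / 2 by rewrite divr_gt0.
apply: neg_le (negD (iz _ e20) (iw _ e20)).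
rewrite addrACA -opprD -scalerDl -splitr; apply: vle_add2r; exact: labsD.
Qed.

Let infZ t z : infinitesimal z -> infinitesimal (t *: z).
Proof.
move=> iz e e0; have t10 : 0 < `|t| + 1 by rewrite ltr_wpDl.
apply: neg_le (negZ (normr_ge0 t) (iz _ (divr_gt0 e0 t10))).
rewrite scalerBr; apply: vle_add; first exact: labsZ_le.
apply: vle_opp; rewrite scalerA; apply: vle_scaler => //.
by rewrite mulrCA ger_pMr// ler_pdivrMr// mul1r lerDl.
Qed.

Let infM x z : infinitesimal z -> infinitesimal (x * z)%g.
Proof.
move=> iz e e0; have x10 : 0 < `|x| + 1 by rewrite ltr_wpDl.
apply: neg_le (neg_mul (labs_ge0 x) (iz _ (divr_gt0 e0 x10))).
rewrite vmulBr; apply: vle_add; first exact: labs_mul.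
apply: vle_opp; rewrite vmulZr.
have xa : (labs x * a)%g <=v (`|x| + 1) *: a.
  by apply: vmul_le_norm => //; rewrite ?norm_labs ?ltrDl//; exact: labs_ge0.
apply: (vle_trans (vle_scale _ xa)); first by rewrite divr_ge0 ?ltW.
by rewrite scalerA divfK ?gt_eqF//; exact: vle_refl.
Qed.

Let infN z : infinitesimal z -> infinitesimal (- z).
Proof. by apply: inf_solid; rewrite labsN; exact: vle_refl. Qed.

Let inf_scale_a t : infinitesimal (t *: a) -> t = 0.
Proof.
have aux u : infinitesimal (u *: a) -> u <= 0.
  move=> iu; rewrite leNgt; apply/negP => u0.
  have u20 : 0 < u / 2 by rewrite divr_gt0.
  have /neg_scale_a : neg ((u / 2) *: a).
    apply: neg_le (iu _ u20).
    rewrite labs_id -?scalerBl; last by apply: vscale_ge0 => //; exact: ltW.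
    by apply: vle_scaler => //; lra.
  by rewrite leNgt u20.
move=> it; apply/le_anti; rewrite aux//= -oppr_le0 aux// scaleNr; exact: infN.
Qed.

(** [r] is the standard part of the quotient of [x * a] by [a], modulo [P]. *)
Definition standard_part x r := infinitesimal ((x * a)%g - r *: a).

Lemma standard_part_uniq x r s : standard_part x r -> standard_part x s -> r = s.
Proof.
move=> xr xs; apply/eqP; rewrite -subr_eq0; apply/eqP/inf_scale_a.
rewrite scalerBl -(subrKA (x * a)%g); apply: infD => //.
by rewrite -opprB; exact: infN.
Qed.

(** The order modulo [P] is total because the ideal is prime and positive and
    negative parts are disjoint; [x * a] lies between multiples of [a] by
    [vmul_le_norm], so a Dedekind cut defines the standard part. *)
Lemma exists_standard_part x : exists2 r, standard_part x r & `|r| <= `|x|.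
Proof.
have xa c : `|x| < c -> labs (x * a)%g <=v c *: a.
  by move=> xc; rewrite labs_mulr//; apply: vmul_le_norm; rewrite ?norm_labs//;
    exact: labs_ge0.
pose S := [set t : R | neg (t *: a - (x * a)%g)].
have S_lower c : `|x| < c -> S (- c).
  move=> /xa /labs_le [_ xac]; apply: neg_le0; rewrite scaleNr addrC.
  by apply/vle_subl; rewrite add0r.
have S_upper c : `|x| < c -> ubound S c.
  move=> /xa /labs_le [xac _] t nt; rewrite -subr_le0; apply: neg_scale_a.
  rewrite scalerBl -(subrKA (x * a)%g); apply: negD => //.
  by apply: neg_le0; apply/vle_subl; rewrite add0r.
have x1 : `|x| < `|x| + 1 by rewrite ltrDl.
have S_sup : has_sup S.
  by split; [exists (- (`|x| + 1)); exact: S_lower|exists (`|x| + 1); exact: S_upper].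
exists (sup S); last first.
  apply/ler_addgt0Pr => e e0; have xe : `|x| < `|x| + e by rewrite ltrDl.
  rewrite ler_norml; apply/andP; split.
    exact: sup_upper_bound S_sup _ (S_lower _ xe).
  exact: ge_sup (proj1 S_sup) (S_upper _ xe).
move=> e e0; apply: neg_labs.
  have [nS|] := neg_total ((x * a)%g - (sup S + e) *: a).
    by rewrite -addrA -opprD -scalerDl.
  rewrite opprB => /(sup_upper_bound S_sup).
  by rewrite gerDl leNgt e0.
have [t St lt_t] := sup_adherent e0 S_sup.
apply: neg_le St; rewrite opprB addrAC -scalerBl; apply: vle_add2r.
by apply: vle_scaler => //; exact: ltW.
Qed.

Lemma standard_part_linear t x y r s : standard_part x r -> standard_part y s ->
  standard_part (t *: x + y) (t * r + s).
Proof.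
move=> xr ys; rewrite /standard_part vmulDl vmulZl scalerDl -scalerA.
by rewrite opprD addrACA -scalerBr; apply: infD ys; exact: infZ.
Qed.

Lemma standard_part_labs x r : standard_part x r -> standard_part (labs x) `|r|.
Proof.
apply: inf_solid; rewrite -labs_mulr//.
have -> : `|r| *: a = labs (r *: a); last exact: labsB_labs.
have [r0|/ltW r0] := leP 0 r.
  by rewrite ger0_norm// labs_id//; exact: vscale_ge0.
by rewrite ler0_norm// scaleNr -labsN labs_id// -scaleNr; apply: vscale_ge0;
  rewrite ?oppr_ge0.
Qed.

(** x y a - r s a = x (y a - s a) + s (x a - r a), and multiplication by [x]
    preserves infinitesimals because it is bounded in order. *)
Lemma standard_part_mul x y r s : standard_part x r -> standard_part y s ->
  standard_part (x * y)%g (r * s).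
Proof.
move=> xr ys; rewrite /standard_part.
have -> : (x * y * a)%g - (r * s) *: a =
    (x * ((y * a)%g - s *: a))%g + s *: ((x * a)%g - r *: a).
  by rewrite vmulBr vmulZr scalerBr subrKA scalerA mulrC mulgA.
by apply: infD; [exact: infM|exact: infZ].
Qed.

(** A standard part equal to zero would give (d / 2) a <= 0 modulo [P]. *)
Lemma standard_part_neq0 (d : R) : 0 < d -> P (vpos (d *: a - (a * a)%g)) ->
  ~ standard_part a 0.
Proof.
move=> d0 nd a00; have d20 : 0 < d / 2 by rewrite divr_gt0.
have := a00 _ d20; rewrite scale0r subr0 => n2.
have /neg_scale_a : neg ((d / 2) *: a).
  apply: neg_le (negD nd n2).
  rewrite [in X in _ <=v X]labs_id; last exact: vmul_ge0.
  by rewrite subrKA -scalerBl; apply: vle_scaler => //; lra.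
by rewrite leNgt d20.
Qed.

End StandardPart.

(** Otherwise, for every d > 0, [a] lies below a multiple of (d a - a a)^+ and is
    therefore disjoint from (a a - d a)^+.  But the latter is at most a a, so at
    most a multiple of [a]; it is disjoint from itself, that is a a <= d a.
    Letting d tend to zero gives a a = 0. *)
Lemma exists_proper_ideal (R : realType) (A : banachFAlgebraType R) (a : A) :
  0 <=v a -> (a * a)%g <> 0 ->
  exists2 d : R, 0 < d & ~ adjoin [set 0] (vpos (d *: a - (a * a)%g)) a.
Proof.
move=> a0 aa; apply: contrapT => no_d; apply: aa.
have aa0 : 0 <=v (a * a)%g by exact: vmul_ge0.
apply: (vle_anti _ aa0); apply: vle0_norm_small => e e0.
have a10 : 0 < `|a| + 1 by rewrite ltr_wpDl.
pose d := e / (`|a| + 1); have d0 : 0 < d by rewrite divr_gt0.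
exists (d *: a).
  by rewrite normrZ gtr0_norm// -mulrA ger_pMr// mulrC ler_pdivrMr// mul1r lerDl.
have [_ [_ -> [n]]] : adjoin [set 0] (vpos (d *: a - (a * a)%g)) a.
  by apply: contrapT => na; apply: no_d; exists d.
rewrite add0r => an.
pose p := vpos ((a * a)%g - d *: a).
have pa : vmeet p a = 0.
  apply: vmeet0S an => //; apply: vmeet0Mn.
  by rewrite /p -[d *: a - _]opprB; exact: vpos_meet0.
pose m := Num.bound `|a|.
have aam : (a * a)%g <=v a *+ m.
  by rewrite -scaler_nat; apply: vmul_le_norm => //; exact: archi_boundP.
have pp : vmeet p p = 0.
  apply: (vmeet0S (vmeet0Mn m pa)) (vpos_ge0 _) _.
  apply: vle_trans aam; apply: vpos_le aa0; apply/vle_subl.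
  by apply: vle_addr_ge0; apply: vscale_ge0 => //; exact: ltW.
have /vpos_eq0 : p = 0.
  apply: vle_anti (vpos_ge0 _); rewrite -pp.
  by apply/vle_meet; split; exact: vle_refl.
by move=> /vle_subl; rewrite add0r.
Qed.

(** The ideal obtained from [exists_proper_ideal] extends to a prime ideal
    that avoids [a] and modulo which d a <= a a; the homomorphism is the
    standard part. *)
Lemma exists_character (R : realType) (A : banachFAlgebraType R) (a : A) :
  0 <=v a -> (a * a)%g <> 0 ->
  exists f : A -> R^o, [/\ lattice_algebra_hom f,
    forall x, `|f x| <= `|x| & f a != 0].
Proof.
move=> a0 aa; have [d d0 nI] := exists_proper_ideal a0 aa.
set z := vpos _ in nI; have z0 : 0 <=v z by exact: vpos_ge0.
have I_ideal := adjoin_ideal (positive_ideal0 A) z0.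
have [P [P_ideal IP nPa P_prime]] := exists_prime_ideal I_ideal nI.
have /choice[f /all_and2[f_std f_le]] x : exists r : R,
    standard_part a P x r /\ `|r| <= `|x|.
  by have [r] := exists_standard_part a0 P_ideal nPa P_prime x; exists r.
have f_uniq x r : standard_part a P x r -> f x = r.
  exact: (standard_part_uniq a0 P_ideal nPa (f_std x)).
have f_lin : linear (f : A -> R^o).
  by move=> t x y; apply: f_uniq; exact: standard_part_linear.
have [|f_meet f_join] := lattice_hom_of_labs f_lin.
  move=> x; rewrite (f_uniq _ _ (standard_part_labs a0 P_ideal (f_std x))).
  exact/esym/labs_scalar.
exists f; split=> //.
  by split=> // x y; apply: f_uniq; exact: standard_part_mul.
apply/eqP => fa0; apply: (standard_part_neq0 a0 P_ideal nPa d0).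
  by apply: IP; apply: mem_adjoin => //; exact: positive_ideal0.
by rewrite -fa0.
Qed.

(** * The Hahn-Banach theorem *)

Section HahnBanach.
Context (R : realType).

Definition sublinear (V : lmodType R) (p : V -> R) : Prop :=
  [/\ p 0 = 0, forall x y, p (x + y) <= p x + p y
    & forall (t : R) x, 0 < t -> p (t *: x) <= t * p x].

Lemma inf_le (S : set R) m c : (forall a, S a -> m <= a) -> S c -> inf S <= c.
Proof. by move=> mS Sc; apply: ge_inf Sc; exists m. Qed.

(** The common pattern of the infimum constructions below: the sets [S x] are
    directed enough for the infimum to inherit subadditivity and homogeneity. *)
Lemma sublinear_inf (V : lmodType R) (S : V -> set R) (m : V -> R) :
  S 0 0 -> m 0 = 0 ->
  (forall x, S x !=set0) ->
  (forall x a, S x a -> m x <= a) ->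
  (forall x y a b, S x a -> S y b -> exists2 c, S (x + y) c & c <= a + b) ->
  (forall (t : R) x a, 0 < t -> S x a -> exists2 c, S (t *: x) c & c <= t * a) ->
  sublinear (fun x => inf (S x)).
Proof.
move=> S00 m0 Sne Sm SD SZ; split.
- apply/le_anti; rewrite (inf_le (Sm 0) S00)/=.
  by apply: lb_le_inf; [exists 0|move=> a /Sm; rewrite m0].
- move=> x y; rewrite -lerBlDr; apply: lb_le_inf; first exact: Sne.
  move=> a Sa; rewrite lerBlDr -lerBlDl.
  apply: lb_le_inf; first exact: Sne.
  move=> b Sb; rewrite lerBlDl.
  by have [c Sc] := SD _ _ _ _ Sa Sb; apply: le_trans; exact: inf_le (Sm _) Sc.
- move=> t x t0; rewrite -ler_pdivrMl//; apply: lb_le_inf; first exact: Sne.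
  move=> a Sa; rewrite ler_pdivrMl//.
  by have [c Sc] := SZ _ _ _ t0 Sa; apply: le_trans; exact: inf_le (Sm _) Sc.
Qed.

Lemma sublinear_ge_opp (V : lmodType R) (p : V -> R) x : sublinear p -> - p (- x) <= p x.
Proof.
move=> [p0 pD _]; rewrite lerNl -subr_ge0 opprK -p0 -(addNr x); exact: pD.
Qed.

(** For each [y], the infimum over t >= 0 of q (x + t y) - t q y is a sublinear
    function of [x] below [q], hence equal to [q]; its value at - y is at most
    - q y, so that [q] is odd, and an odd sublinear function is linear. *)
Lemma minimal_sublinear_linear (V : lmodType R) (q : V -> R) : sublinear q ->
  (forall q', sublinear q' -> (forall x, q' x <= q x) -> q' = q) ->
  linear (q : V -> R^o).
Proof.
move=> q_sub q_min; have [q0 qD qZ] := q_sub.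
have qZ' (t : R) x : 0 <= t -> t * q x <= q (t *: x).
  rewrite le_eqVlt => /orP[/eqP<-|t0]; first by rewrite scale0r q0 mul0r.
  rewrite -ler_pdivlMl// -{1}[x](scalerK (lt0r_neq0 t0)).
  by apply: qZ; rewrite invr_gt0.
have qN y : q (- y) = - q y.
  apply/le_anti; rewrite lerNl (sublinear_ge_opp _ q_sub) andbT.
  pose S x := [set a : R | exists2 t : R, 0 <= t & a = q (x + t *: y) - t * q y].
  have S_lower x a : S x a -> - q (- x) <= a.
    move=> [t t0 ->]; rewrite lerBrDr (le_trans (lerD (lexx _) (qZ' t y t0)))//.
    by have := qD (- x) (x + t *: y); rewrite addKr; lra.
  have S_q x : S x (q x) by exists 0 => //; rewrite scale0r addr0 mul0r subr0.
  have inf_q : (fun x => inf (S x)) = q.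
    apply: q_min; last by move=> x; exact: inf_le (S_lower x) (S_q x).
    apply: (@sublinear_inf _ _ (fun x => - q (- x))) => //.
    - by have := S_q 0; rewrite q0.
    - by rewrite oppr0 q0 oppr0.
    - by move=> x; exists (q x).
    - move=> x x' _ _ [t t0 ->] [t' t'0 ->].
      exists (q (x + x' + (t + t') *: y) - (t + t') * q y).
        by exists (t + t') => //; exact: addr_ge0.
      rewrite [leRHS]addrACA -opprD -mulrDl lerD2r scalerDl addrACA; exact: qD.
    - move=> s x _ s0 [t t0 ->].
      exists (q (s *: x + (s * t) *: y) - (s * t) * q y).
        by exists (s * t) => //; rewrite mulr_ge0// ltW.
      by rewrite mulrBr mulrA lerD2r -scalerA -scalerDr; exact: qZ.
  have /= <- := congr1 (fun r => r (- y)) inf_q.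
  apply: inf_le (S_lower _) _; exists 1; rewrite ?ler01//.
  by rewrite scale1r addNr q0 mul1r sub0r.
have qDe x y : q (x + y) = q x + q y.
  by apply/le_anti; rewrite qD/= -lerN2 opprD -!qN opprD qD.
have qZe (t : R) x : 0 <= t -> q (t *: x) = t * q x.
  rewrite le_eqVlt => /orP[/eqP<-|t0]; first by rewrite scale0r q0 mul0r.
  by apply/le_anti; rewrite qZ// qZ'// ltW.
move=> t x y; rewrite qDe; congr (_ + _).
have [t0|/ltW t0] := leP 0 t; first exact: qZe.
by rewrite -[t]opprK scaleNr qN qZe ?oppr_ge0// scaleNr.
Qed.

(** The sublinear functions below [p] have a minimal element by Zorn's lemma. *)
Lemma exists_linear_le_sublinear (V : lmodType R) (p : V -> R) : sublinear p ->
  exists2 f : V -> R^o, linear f & forall x, f x <= p x.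
Proof.
move=> p_sub.
pose T := {q : V -> R | sublinear q /\ forall x, q x <= p x}.
pose le (q q' : T) := `[< forall x, sval q' x <= sval q x >].
have [|q r s /asboolP qr /asboolP rs|q r /asboolP qr /asboolP rq|A A_tot|q q_max] :=
    @Zorn T le.
- by move=> q; apply/asboolP.
- by apply/asboolP => x; exact: le_trans (rs x) (qr x).
- case: q r qr rq => [q q_sub] [r r_sub] /= qr rq; apply: eq_exist.
  by apply/funext => x; apply/le_anti; rewrite rq qr.
(* The function p is added to the chain so that infima are over nonempty sets. *)
- pose B q := q = p \/ exists2 r, A r & q = sval r.
  have B_sub q : B q -> sublinear q.
    by move=> [->//|[r _ ->]]; case: (svalP r).
  have B_p q x : B q -> q x <= p x.
    by move=> [->//|[r _ ->]]; case: (svalP r) => _; apply.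
  have B_tot q r : B q -> B r -> exists2 s, B s &
      forall x, s x <= q x /\ s x <= r x.
    move=> [->|[q' Aq ->]] Br; first by exists r => // x; rewrite B_p.
    case: Br => [->|[r' Ar ->]].
      exists (sval q') => [|x]; first by right; exists q'.
      by split=> //; case: (svalP q') => _; apply.
    have [/asboolP qr|/asboolP rq] := A_tot _ _ Aq Ar.
      by exists (sval r') => [|x//]; right; exists r'.
    by exists (sval q') => [|x//]; right; exists q'.
  pose S x := [set a : R | exists2 q, B q & a = q x].
  have Bp : B p by left.
  have S_lower x a : S x a -> - p (- x) <= a.
    move=> [q Bq ->]; rewrite (le_trans _ (sublinear_ge_opp _ (B_sub _ Bq)))//.
    by rewrite lerN2; exact: B_p.
  have inf_sub : sublinear (fun x => inf (S x)).
    have p0 : p 0 = 0 by case: p_sub.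
    apply: (@sublinear_inf _ _ (fun x => - p (- x))) => //.
    - by exists p.
    - by rewrite oppr0 p0 oppr0.
    - by move=> x; exists (p x); exists p.
    - move=> x y _ _ [q Bq ->] [r Br ->]; have [s Bs s_le] := B_tot _ _ Bq Br.
      exists (s (x + y)); first by exists s.
      have [_ sD _] := B_sub _ Bs; apply: (le_trans (sD _ _)).
      by apply: lerD; apply s_le.
    - move=> t x _ t0 [q Bq ->]; exists (q (t *: x)); first by exists q.
      by have [_ _] := B_sub _ Bq; apply.
  have inf_p x : inf (S x) <= p x by apply: inf_le (S_lower x) _; exists p.
  exists (exist _ (fun x => inf (S x)) (conj inf_sub inf_p)) => q Aq.
  apply/asboolP => x /=; apply: inf_le (S_lower x) _; exists (sval q) => //.
  by right; exists q.
case: q q_max => q [q_sub q_p] q_max; exists q => //.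
apply: minimal_sublinear_linear => // r r_sub rq.
have r_p x : r x <= p x by exact: le_trans (rq x) (q_p x).
by have /(congr1 sval) := q_max (exist _ r (conj r_sub r_p)) (asboolT rq).
Qed.

(** A convex cone of constraints f x >= r is compatible with the norm bound as
    soon as each single constraint is.  The functional lies below the sublinear
    function that sends y to the infimum of |y + x| - r over the cone.  Taking
    the cone of the pairs (T x, f x) extends functionals; taking that of the
    pairs (t y - T x, t e) separates [y] from the range of T. *)
Lemma hahn_banach (F : normedModType R) (C : F -> R -> Prop) :
  C 0 0 ->
  (forall x y r s, C x r -> C y s -> C (x + y) (r + s)) ->
  (forall (t : R) x r, 0 < t -> C x r -> C (t *: x) (t * r)) ->
  (forall x r, C x r -> r <= `|x|) ->
  exists f : F -> R^o, [/\ linear f, forall x, `|f x| <= `|x|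
    & forall x r, C x r -> r <= f x].
Proof.
move=> C0 CD CZ C_le.
pose S y := [set a : R | exists x r, C x r /\ a = `|y + x| - r].
have S_lower y a : S y a -> - `|y| <= a.
  move=> [x [r [/C_le rx ->]]]; rewrite lerBrDr (le_trans (lerD (lexx _) rx))//.
  by have := ler_normB (y + x) y; rewrite addrAC subrr add0r; lra.
have [f f_lin f_le] : exists2 f : F -> R^o, linear f & forall y, f y <= inf (S y).
  apply: exists_linear_le_sublinear; apply: (@sublinear_inf _ _ (fun y => - `|y|)) => //.
  - by exists 0, 0; rewrite addr0 normr0 subr0.
  - by rewrite normr0 oppr0.
  - by move=> y; exists `|y|, 0, 0; rewrite addr0 subr0.
  - move=> y y' _ _ [x [r [Cx ->]]] [x' [r' [Cx' ->]]].
    exists (`|y + y' + (x + x')| - (r + r')); last first.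
      by rewrite [leRHS]addrACA -opprD lerD2r addrACA ler_normD.
    by exists (x + x'), (r + r'); split => //; exact: CD.
  - move=> t y _ t0 [x [r [Cx ->]]].
    exists (`|t *: y + t *: x| - t * r); last first.
      by rewrite -scalerDr normrZ gtr0_norm// mulrBr.
    by exists (t *: x), (t * r); split => //; exact: CZ.
have f_norm y : f y <= `|y|.
  apply: le_trans (f_le y) _; apply: inf_le (S_lower y) _.
  by exists 0, 0; rewrite addr0 subr0.
exists f; split=> // [y|x r Cx].
  by rewrite ler_norml f_norm andbT lerNl -(linN f_lin) -normrN.
rewrite -[f x]opprK -(linN f_lin) lerNr; apply: le_trans (f_le _) _.
by apply: inf_le (S_lower _) _; exists x, r; rewrite addNr normr0 sub0r.
Qed.

End HahnBanach.

(** * Subalgebras with a complete norm *)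

Lemma exists_pow2_le (R : realType) (e : R) : 0 < e ->
  exists M, forall n, (M <= n)%N -> 2 ^- n <= e.
Proof.
move=> e0; exists (Num.bound e^-1) => n Mn.
rewrite -[leRHS]invrK lef_pV2 ?posrE ?invr_gt0 ?exprn_gt0//.
rewrite ltW// (lt_le_trans (archi_boundP _)) ?invr_ge0 ?ltW//.
by rewrite -natrX ltr_nat (leq_ltn_trans Mn)// ltn_expl.
Qed.

(** Completeness in the form used below, without filters. *)
Lemma fast_cauchy_cvg (R : realType) (V : completeNormedModType R) (u : nat -> V) :
  (forall n, `|u n.+1 - u n| <= 2 ^- n) ->
  exists l, forall e : R, 0 < e -> exists N, forall n, (N <= n)%N -> `|l - u n| <= e.
Proof.
move=> u_fast.
have u_le n k : `|u (n + k)%N - u n| <= 2 ^- n * (2 - 2 * 2 ^- k).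
  elim: k => [|k IHk].
    by rewrite addn0 !subrr normr0 expr0 invr1 mulr1 subrr mulr0.
  rewrite addnS -(subrKA (u (n + k)%N)) (le_trans (ler_normD _ _))//.
  rewrite (le_trans (lerD (u_fast _) IHk))// exprD exprS invfM -mulrDr.
  rewrite ler_pM2l ?invr_gt0 ?exprn_gt0//.
  have : 0 < 2 ^- k :> R by rewrite invr_gt0 exprn_gt0.
  by rewrite invfM; set t := 2 ^- k; lra.
have /cvg_ex[l ul] : cvg (u @ \oo).
  apply/cauchy_cvgP/cauchy_exP => e e0.
  have e40 : 0 < e / 4 by rewrite divr_gt0.
  have [N hN] := exists_pow2_le e40.
  exists (u N); exists N => // n Nn; rewrite -ball_normE /= distrC.
  rewrite -(subnKC Nn) (le_lt_trans (u_le _ _))//.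
  have hk : 0 < 2 ^- (n - N) :> R by rewrite invr_gt0 exprn_gt0.
  rewrite (@le_lt_trans _ _ (2 ^- N * 2))//.
    by rewrite ler_pM2l ?invr_gt0 ?exprn_gt0// lerBlDr lerDl mulr_ge0// ltW.
  by have := hN N (leqnn _); lra.
exists l => e e0.
have /cvgrPdist_le /(_ _ e0) [N _ hN] := ul.
by exists N => n Nn; exact: hN.
Qed.

Section BanachSubalgebra.
Variables (R : realType) (A : fAlgebraType R).

(** A subalgebra and sublattice of [A] with a complete submultiplicative lattice
    norm of its own, which need not be the restriction of a norm of [A]: this
    covers both a closed subalgebra and the range of a homomorphism with the
    quotient norm.  Meets and joins are recovered from the modulus. *)
Record banach_subalg := BanachSubalg {
  carrier : {pred A};
  gauge : A -> R;
  carrier_submod : submod_closed carrier;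
  carrier_labs : forall x, x \in carrier -> labs x \in carrier;
  carrier_mulg : forall x y, x \in carrier -> y \in carrier -> (x * y)%g \in carrier;
  gaugeD : forall x y, x \in carrier -> y \in carrier ->
    gauge (x + y) <= gauge x + gauge y;
  gaugeZ_le : forall a x, x \in carrier -> gauge (a *: x) <= `|a| * gauge x;
  gauge0_eq0 : forall x, x \in carrier -> gauge x = 0 -> x = 0;
  gauge_lattice : forall x y, x \in carrier -> y \in carrier ->
    vle (labs x) (labs y) -> gauge x <= gauge y;
  gaugeM : forall x y, x \in carrier -> y \in carrier ->
    gauge (x * y)%g <= gauge x * gauge y;
  gauge_complete : forall u : nat -> A, (forall n, u n \in carrier) ->
    (forall n, gauge (u n.+1 - u n) <= 2 ^- n) ->
    exists2 l, l \in carrier & forall e, 0 < e ->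
      exists N, forall n, (N <= n)%N -> gauge (l - u n) <= e
}.

Variable D : banach_subalg.

HB.instance Definition _ := GRing.isSubmodClosed.Build R A (carrier D) (carrier_submod D).

Inductive subalg : predArgType := InSubalg u & u \in carrier D.

Definition subalg_incl (x : subalg) : A := let: InSubalg u _ := x in u.
HB.instance Definition _ := [isSub of subalg for subalg_incl].
HB.instance Definition _ := [Choice of subalg by <:].
HB.instance Definition _ := [SubChoice_isSubZmodule of subalg by <:].
HB.instance Definition _ := [SubZmodule_isSubLmodule of subalg by <:].

Lemma subalg_inclP (x : subalg) : subalg_incl x \in carrier D.
Proof. by case: x. Qed.

Lemma carrier_pos x : x \in carrier D -> vpos x \in carrier D.
Proof.
by move=> xD; rewrite vpos_labs; apply: rpredZ; apply: rpredD => //; exact: carrier_labs.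
Qed.

Lemma carrier_join (x y : subalg) : vjoin (subalg_incl x) (subalg_incl y) \in carrier D.
Proof.
rewrite vjoinE; apply: rpredD; first exact: subalg_inclP.
by apply: carrier_pos; apply: rpredB; exact: subalg_inclP.
Qed.

Lemma carrier_meet (x y : subalg) : vmeet (subalg_incl x) (subalg_incl y) \in carrier D.
Proof.
by rewrite vmeetE; apply: rpredB (carrier_join x y); apply: rpredD; exact: subalg_inclP.
Qed.

Lemma carrier_mul (x y : subalg) : (subalg_incl x * subalg_incl y)%g \in carrier D.
Proof. by apply: carrier_mulg; exact: subalg_inclP. Qed.

Let subalg_le (x y : subalg) := vle (subalg_incl x) (subalg_incl y).
Let subalg_meet (x y : subalg) := InSubalg (carrier_meet x y).
Let subalg_join (x y : subalg) := InSubalg (carrier_join x y).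
Let subalg_mul (x y : subalg) := InSubalg (carrier_mul x y).
Implicit Types x y z : subalg.

Fact subalg_le_refl x : subalg_le x x.
Proof. exact: vle_refl. Qed.

Fact subalg_le_anti x y : subalg_le x y -> subalg_le y x -> x = y.
Proof. by move=> h k; apply/val_inj/vle_anti. Qed.

Fact subalg_le_trans y x z : subalg_le x y -> subalg_le y z -> subalg_le x z.
Proof. exact: vle_trans. Qed.

Fact subalg_le_meet x y z :
  subalg_le z (subalg_meet x y) <-> subalg_le z x /\ subalg_le z y.
Proof. exact: vle_meet. Qed.

Fact subalg_join_le x y z :
  subalg_le (subalg_join x y) z <-> subalg_le x z /\ subalg_le y z.
Proof. exact: vjoin_le. Qed.

Fact subalg_le_add2r z x y : subalg_le x y -> subalg_le (x + z) (y + z).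
Proof. exact: vle_add2r. Qed.

Fact subalg_scale_ge0 (a : R) x : 0 <= a -> subalg_le 0 x -> subalg_le 0 (a *: x).
Proof. exact: vscale_ge0. Qed.

HB.instance Definition _ := Lmodule_isVectorLattice.Build R subalg
  subalg_le_refl subalg_le_anti subalg_le_trans subalg_le_meet subalg_join_le
  subalg_le_add2r subalg_scale_ge0.

Fact subalg_mulA : associative subalg_mul.
Proof. move=> x y z; apply/val_inj; exact: mulgA. Qed.

HB.instance Definition _ := isSemigroup.Build subalg subalg_mulA.

Fact subalg_mulDl x y z : ((x + y) * z)%g = (x * z)%g + (y * z)%g.
Proof. exact/val_inj/vmulDl. Qed.

Fact subalg_mulDr x y z : (x * (y + z))%g = (x * y)%g + (x * z)%g.
Proof. exact/val_inj/vmulDr. Qed.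

Fact subalg_mulZl (a : R) x y : ((a *: x) * y)%g = a *: (x * y)%g.
Proof. exact/val_inj/vmulZl. Qed.

Fact subalg_mulZr (a : R) x y : (x * (a *: y))%g = a *: (x * y)%g.
Proof. exact/val_inj/vmulZr. Qed.

Fact subalg_mul_ge0 x y : vle 0 x -> vle 0 y -> vle 0 (x * y)%g.
Proof. exact: vmul_ge0. Qed.

HB.instance Definition _ := VectorLattice_isAlgebra.Build R subalg
  subalg_mulDl subalg_mulDr subalg_mulZl subalg_mulZr subalg_mul_ge0.

Fact subalg_mul_meet0 (a b c : subalg) : vmeet a b = 0 -> vle 0 c ->
  vmeet (a * c)%g b = 0 /\ vmeet (c * a)%g b = 0.
Proof.
move=> /(congr1 val) ab c0.
have [] := @vmul_meet0 R A (subalg_incl a) (subalg_incl b) (subalg_incl c) ab c0.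
by split; apply/val_inj.
Qed.

HB.instance Definition _ :=
  VectorLatticeAlgebra_isFAlgebra.Build R subalg subalg_mul_meet0.

Let subalg_gauge (x : subalg) := gauge D (subalg_incl x).

Fact subalg_normD x y : subalg_gauge (x + y) <= subalg_gauge x + subalg_gauge y.
Proof. by apply: gaugeD; exact: subalg_inclP. Qed.

Fact subalg_normZ (a : R) x : subalg_gauge (a *: x) = `|a| * subalg_gauge x.
Proof.
have gauge_le b y : subalg_gauge (b *: y) <= `|b| * subalg_gauge y.
  by apply: gaugeZ_le; exact: subalg_inclP.
apply/le_anti; rewrite gauge_le/=.
have [->|a0] := eqVneq a 0.
  have := subalg_normD 0 0; rewrite normr0 mul0r scale0r addr0.
  by rewrite -lerBlDr subrr.
rewrite -ler_pdivlMl ?normr_gt0// -normfV -{1}[x](scalerK a0); exact: gauge_le.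
Qed.

Fact subalg_norm0_eq0 x : subalg_gauge x = 0 -> x = 0.
Proof. by move=> h; apply/val_inj/(gauge0_eq0 (subalg_inclP x) h). Qed.

HB.instance Definition _ := Lmodule_isNormed.Build R subalg
  subalg_normD subalg_normZ subalg_norm0_eq0.

(** Points chosen in small sets of a Cauchy filter form a fast Cauchy sequence. *)
Fact subalg_complete (F : set_system subalg) : ProperFilter F -> cauchy F -> cvg F.
Proof.
move=> PF /cauchyP F_cauchy.
have e_gt0 n : 0 < 2 ^- n.+2 :> R by rewrite invr_gt0 exprn_gt0.
have /choice[x Fx] n := F_cauchy _ (e_gt0 n).
have x_fast n : gauge D (subalg_incl (x n.+1) - subalg_incl (x n)) <= 2 ^- n.
  have [z []] := filter_ex (filterI (Fx n.+1) (Fx n)).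
  rewrite -!ball_normE /= => zSn zn.
  change (`|x n.+1 - x n| <= 2 ^- n).
  rewrite -(subrKA z) (le_trans (ler_normD _ _))//.
  rewrite (le_trans (lerD (ltW zSn) (ltW (_ : _ < 2 ^- n.+2))))//.
    by rewrite distrC; exact: zn.
  have -> : 2 ^- n.+3 = 2 ^- n.+2 / 2 :> R by rewrite exprSr invfM mulrC.
  have -> : 2 ^- n = 2 ^- n.+2 * 4 :> R.
    by rewrite !exprS; field; rewrite expf_neq0.
  by have := e_gt0 n; lra.
have [l lD l_lim] := gauge_complete (fun n => subalg_inclP (x n)) x_fast.
apply/cvg_ex; exists (InSubalg lD); apply/cvgrPdist_le => e e0.
have e20 : 0 < e / 2 by rewrite divr_gt0.
have [N hN] := l_lim _ e20.
have [M hM] := exists_pow2_le e20.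
have := Fx (maxn N M); apply: filterS => z.
rewrite -ball_normE /= => xz.
rewrite -(subrKA (x (maxn N M))) (le_trans (ler_normD _ _))// [leRHS]splitr.
rewrite lerD//; first exact: hN (leq_maxl _ _).
by rewrite (le_trans (ltW xz))// hM// (leq_trans (leq_maxr N M))// leqW.
Qed.

HB.instance Definition _ := Uniform_isComplete.Build subalg subalg_complete.

Fact subalg_lattice_norm x y : vle (labs x) (labs y) -> `|x| <= `|y|.
Proof. by apply: gauge_lattice; exact: subalg_inclP. Qed.

Fact subalg_normM x y : `|(x * y)%g| <= `|x| * `|y|.
Proof. by apply: gaugeM; exact: subalg_inclP. Qed.

HB.instance Definition _ :=
  FAlgebra_isBanach.Build R subalg subalg_lattice_norm subalg_normM.

End BanachSubalgebra.

Lemma subalg_incl_hom (R : realType) (A : fAlgebraType R) (D : banach_subalg A) :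
  lattice_algebra_hom (@subalg_incl R A D).
Proof. by split. Qed.

Section Range.
Context (R : realType) (A B : banachFAlgebraType R) (g : A -> B).
Hypotheses (g_hom : lattice_algebra_hom g) (g_le : forall x, `|g x| <= `|x|).

Let g_lin : linear g. Proof. by case: g_hom. Qed.

(** The quotient norm of the range of [g], isomorphic to [A] modulo the kernel. *)
Definition range_norm (y : B) : R := inf [set `|x| | x in g @^-1` [set y]].

Lemma range_norm_le x : range_norm (g x) <= `|x|.
Proof. by apply: ge_inf; [exists 0 => _ [z _ <-]|exists x]. Qed.

Lemma range_norm_ge x : `|g x| <= range_norm (g x).
Proof.
by apply: lb_le_inf; [exists `|x|, x|move=> _ [z /= <- <-]; exact: g_le].
Qed.

Lemma range_norm_adherent x e : 0 < e ->
  exists2 x', g x' = g x & `|x'| <= range_norm (g x) + e.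
Proof.
move=> e0; have [|_ [x' /= gx' <-] /ltW x'_le] :=
    @inf_adherent R [set `|z| | z in g @^-1` [set g x]] e e0; last by exists x'.
by split; [exists `|x|, x|exists 0 => _ [z _ <-]].
Qed.

Definition in_range : {pred B} := [pred y | `[< exists x, g x = y >]].

Lemma in_rangeP y : reflect (exists x, g x = y) (y \in in_range).
Proof. exact: asboolP. Qed.

Fact range_submod : submod_closed in_range.
Proof.
split=> [|a _ _ /in_rangeP[x <-] /in_rangeP[y <-]].
  by apply/in_rangeP; exists 0; exact: lin0.
by apply/in_rangeP; exists (a *: x + y); exact: g_lin.
Qed.

Fact range_labs y : y \in in_range -> labs y \in in_range.
Proof. by move=> /in_rangeP[x <-]; apply/in_rangeP; exists (labs x); exact: hom_labs. Qed.

Fact range_mul y z : y \in in_range -> z \in in_range -> (y * z)%g \in in_range.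
Proof.
move=> /in_rangeP[x <-] /in_rangeP[w <-]; apply/in_rangeP; exists (x * w)%g.
by case: g_hom.
Qed.

Fact range_normD y z : y \in in_range -> z \in in_range ->
  range_norm (y + z) <= range_norm y + range_norm z.
Proof.
move=> /in_rangeP[x <-] /in_rangeP[w <-]; apply/ler_addgt0Pr => e e0.
have e20 : 0 < e / 2 by rewrite divr_gt0.
have [x' <- x'_le] := range_norm_adherent x e20.
have [w' <- w'_le] := range_norm_adherent w e20.
rewrite -(linD g_lin) (le_trans (range_norm_le _))//.
rewrite (le_trans (ler_normD _ _))// (le_trans (lerD x'_le w'_le))//.
by rewrite addrACA -splitr.
Qed.

Fact range_normZ a y : y \in in_range -> range_norm (a *: y) <= `|a| * range_norm y.
Proof.
move=> /in_rangeP[x <-]; apply/ler_addgt0Pr => e e0.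
have a10 : 0 < `|a| + 1 by rewrite ltr_wpDl.
have [x' gx' x'_le] := range_norm_adherent x (divr_gt0 e0 a10).
rewrite -{1}gx' -(linZ g_lin) (le_trans (range_norm_le _))// normrZ.
rewrite (le_trans (ler_wpM2l (normr_ge0 a) x'_le))// mulrDr lerD2l.
by rewrite mulrCA ger_pMr// ler_pdivrMr// mul1r lerDl.
Qed.

Fact range_norm0_eq0 y : y \in in_range -> range_norm y = 0 -> y = 0.
Proof.
by move=> /in_rangeP[x <-] y0; apply/normr0_eq0/le_anti; rewrite -{1}y0 range_norm_ge/=.
Qed.

(** A preimage of [y] can be truncated to lie between plus and minus the
    modulus of a given preimage of [z]. *)
Fact range_norm_lattice y z : y \in in_range -> z \in in_range ->
  vle (labs y) (labs z) -> range_norm y <= range_norm z.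
Proof.
move=> /in_rangeP[x <-] /in_rangeP[w <-] yz; apply/ler_addgt0Pr => e e0.
have [w' gw' w'_le] := range_norm_adherent w e0.
pose x' := vjoin (vmeet x (labs w')) (- labs w').
have -> : g x = g x'.
  have [_ gM gJ _] := g_hom.
  rewrite gJ gM (linN g_lin) (hom_labs _ g_hom) gw'.
  have [xw Nxw] := proj1 (labs_le _ _) yz.
  have -> : vmeet (g x) (labs (g w)) = g x.
    apply: vle_anti; first exact: vmeet_lel.
    by apply/vle_meet; split=> //; exact: vle_refl.
  apply: vle_anti; first exact: vle_joinl.
  apply/vjoin_le; split; first exact: vle_refl.
  by rewrite -[g x]opprK; exact: vle_opp.
rewrite (le_trans (range_norm_le _))// (le_trans _ w'_le)//.
rewrite -[leRHS]norm_labs; apply: vle_norm_labs; apply/labs_le; split.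
  apply/vjoin_le; split; first exact: vmeet_ler.
  apply: (vle_trans _ (labs_ge0 w')); rewrite -oppr0; apply: vle_opp; exact: labs_ge0.
by rewrite -[labs w']opprK; apply: vle_opp; exact: vle_joinr.
Qed.

Fact range_normM y z : y \in in_range -> z \in in_range ->
  range_norm (y * z)%g <= range_norm y * range_norm z.
Proof.
move=> /in_rangeP[x <-] /in_rangeP[w <-]; apply/ler_addgt0Pr => e e0.
have x0 : 0 <= range_norm (g x) by apply: le_trans (range_norm_ge x).
have w0 : 0 <= range_norm (g w) by apply: le_trans (range_norm_ge w).
set r := range_norm (g x) in x0 *; set s := range_norm (g w) in w0 *.
(* Lifts with excess d give (r + d) (s + d) <= r s + d (r + s + 1), as d <= 1. *)
have rs1 : 0 < r + s + 1 by rewrite ltr_wpDl ?addr_ge0.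
pose d := Num.min 1 (e / (r + s + 1)).
have d0 : 0 < d by rewrite lt_min ltr01 divr_gt0.
have d1 : d <= 1 by rewrite ge_min lexx.
have d_le : d * (r + s + 1) <= e by rewrite -ler_pdivlMr// ge_min lexx orbT.
have [x' gx' x'_le] := range_norm_adherent x d0.
have [w' gw' w'_le] := range_norm_adherent w d0.
have [_ _ _ gM] := g_hom; rewrite -gx' -gw' -gM.
rewrite (le_trans (range_norm_le _))// (le_trans (norm_submultiplicative _ _))//.
rewrite (le_trans (ler_pM _ _ x'_le w'_le))// -/r -/s.
have dd : d * d <= d by rewrite ger_pMl.
by rewrite !mulrDl !mulrDr; nra.
Qed.

(** Lift the increments to summable elements of [A]. *)
Fact range_norm_complete (u : nat -> B) : (forall n, u n \in in_range) ->
  (forall n, range_norm (u n.+1 - u n) <= 2 ^- n) ->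
  exists2 l, l \in in_range & forall e, 0 < e ->
    exists N, forall n, (N <= n)%N -> range_norm (l - u n) <= e.
Proof.
move=> u_in u_fast.
(* The increments start at u 2 - u 1, whose gauge is at most 1/2: this leaves
   room for lifts of norm at most 2^-n. *)
have /choice[v v_def] n : exists v, [/\ g v = u n.+2 - u n.+1 & `|v| <= 2 ^- n].
  have /in_rangeP[x gx] : u n.+2 - u n.+1 \in in_range.
    by have /in_rangeP[x <-] := u_in n.+2; have /in_rangeP[z <-] := u_in n.+1;
      apply/in_rangeP; exists (x - z); rewrite (linB g_lin).
  have e0 : 0 < 2 ^- n.+1 :> R by rewrite invr_gt0 exprn_gt0.
  have [x' gx' x'_le] := range_norm_adherent x e0.
  exists x'; rewrite gx' gx; split=> //; apply: le_trans x'_le _.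
  rewrite gx (le_trans (lerD (u_fast _) (lexx _)))//.
  by rewrite exprS invfM; lra.
have /in_rangeP[w gw] := u_in 1%N.
pose s n := w + \sum_(k < n) v k.
have gs n : g (s n) = u n.+1.
  elim: n => [|n IHn]; first by rewrite /s big_ord0 addr0.
  by rewrite /s big_ord_recr/= addrA (linD g_lin) -/(s n) IHn;
    case: (v_def n) => -> _; rewrite addrC subrK.
have [n|l s_l] := @fast_cauchy_cvg R A s.
  rewrite /s big_ord_recr/= addrA [X in X - _]addrC addrK.
  by case: (v_def n).
exists (g l); first by apply/in_rangeP; exists l.
move=> e /s_l [N hN]; exists N.+1 => -[//|n] Nn.
by rewrite -gs -(linB g_lin) (le_trans (range_norm_le _))// hN.
Qed.

Definition range_subalg : banach_subalg B :=
  BanachSubalg range_submod range_labs range_mul range_normD range_normZ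
    range_norm0_eq0 range_norm_lattice range_normM range_norm_complete.

End Range.

Section Closure.
Context (R : realType) (A B : banachFAlgebraType R) (g : A -> B).
Hypothesis g_hom : lattice_algebra_hom g.

Let g_lin : linear g. Proof. by case: g_hom. Qed.

Definition in_closure : {pred B} :=
  [pred y | `[< forall e : R, 0 < e -> exists x, `|y - g x| <= e >]].

Lemma in_closureP y :
  reflect (forall e : R, 0 < e -> exists x, `|y - g x| <= e) (y \in in_closure).
Proof. exact: asboolP. Qed.

Fact closure_submod : submod_closed in_closure.
Proof.
split=> [|a y z /in_closureP yP /in_closureP zP]; apply/in_closureP => e e0.
  by exists 0; rewrite (lin0 g_lin) subrr normr0 ltW.
have a10 : 0 < `|a| + 1 by rewrite ltr_wpDl.
have [x yx] := yP _ (divr_gt0 e0 a10).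
have e'0 : 0 < e / (`|a| + 1) by rewrite divr_gt0.
have [w zw] := zP _ e'0.
exists (a *: x + w); rewrite g_lin opprD addrACA -scalerBr.
rewrite (le_trans (ler_normD _ _))// normrZ.
rewrite (le_trans (lerD (ler_wpM2l (normr_ge0 a) yx) zw))//.
by rewrite -{2}[e / _]mul1r -mulrDl mulrCA divff ?mulr1// gt_eqF.
Qed.

Fact closure_labs y : y \in in_closure -> labs y \in in_closure.
Proof.
move=> /in_closureP yP; apply/in_closureP => e e0.
have [x yx] := yP e e0; exists (labs x); rewrite (hom_labs _ g_hom).
apply: le_trans yx; apply: lattice_norm; exact: labsB_labs.
Qed.

Fact closure_mul y z : y \in in_closure -> z \in in_closure ->
  (y * z)%g \in in_closure.
Proof.
move=> /in_closureP yP /in_closureP zP; apply/in_closureP => e e0.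
have c0 : 0 < `|y| + `|z| + 1 by rewrite ltr_wpDl ?addr_ge0.
pose d := Num.min 1 (e / (`|y| + `|z| + 1)).
have d0 : 0 < d by rewrite lt_min ltr01 divr_gt0.
have d1 : d <= 1 by rewrite ge_min lexx.
have d_le : d * (`|y| + `|z| + 1) <= e by rewrite -ler_pdivlMr// ge_min lexx orbT.
have [x yx] := yP d d0; have [w zw] := zP d d0.
exists (x * w)%g; have [_ _ _ ->] := g_hom.
have -> : (y * z)%g - (g x * g w)%g = ((y - g x) * z)%g + (g x * (z - g w))%g.
  by rewrite vmulBl vmulBr subrKA.
rewrite (le_trans (ler_normD _ _))//.
have gx_le : `|g x| <= `|y| + 1.
  rewrite -[g x](subKr y) (le_trans (ler_normB _ _))// lerD2l.
  exact: le_trans d1.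
rewrite (le_trans (lerD (norm_submultiplicative _ _) (norm_submultiplicative _ _)))//.
have : `|y - g x| * `|z| <= d * `|z| by rewrite ler_wpM2r.
have : `|g x| * `|z - g w| <= (`|y| + 1) * d by rewrite ler_pM.
by move: d_le; nra.
Qed.

Fact closure_complete (u : nat -> B) : (forall n, u n \in in_closure) ->
  (forall n, `|u n.+1 - u n| <= 2 ^- n) ->
  exists2 l, l \in in_closure & forall e : R, 0 < e ->
    exists N, forall n, (N <= n)%N -> `|l - u n| <= e.
Proof.
move=> u_in /fast_cauchy_cvg [l ul]; exists l => //; apply/in_closureP => e e0.
have e20 : 0 < e / 2 by rewrite divr_gt0.
have [N hN] := ul _ e20; have /in_closureP /(_ _ e20) [x ux] := u_in N.
exists x; rewrite -(subrKA (u N)) (le_trans (ler_normD _ _))// [leRHS]splitr.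
exact: lerD (hN _ (leqnn _)) ux.
Qed.

Definition closure_subalg : banach_subalg B.
Proof.
apply: (@BanachSubalg R B in_closure (fun y => `|y|)
  closure_submod closure_labs closure_mul _ _ _ _ _ closure_complete).
- by move=> y z _ _; exact: ler_normD.
- by move=> a y _; rewrite normrZ.
- by move=> y _; exact: normr0_eq0.
- by move=> y z _ _; exact: lattice_norm.
- by move=> y z _ _; exact: norm_submultiplicative.
Defined.

End Closure.

(** * Free Banach f-algebras *)

Section FreeBanachFAlgebra.
Context (R : realType) (E : completeNormedModType R) (FE : banachFAlgebraType R).
Context (eta : E -> FE) (eta_free : is_FBfA eta).

Lemma free_lin : linear eta. Proof. by case: eta_free. Qed.

Lemma free_norm x : `|eta x| = `|x|. Proof. by case: eta_free. Qed.

Lemma free_lift (B : banachFAlgebraType R) (f : E -> B) :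
  linear f -> (forall x, `|f x| <= `|x|) ->
  exists h : FE -> B, [/\ lattice_algebra_hom h, forall x, h (eta x) = f x
    & forall a, `|h a| <= `|a|].
Proof.
move=> f_lin /(proj2 (contractiveP f_lin)) f_c; case: eta_free => _ _.
move=> /(_ B f f_lin f_c) [h [h_hom h_eta h_norm _]]; exists h; split=> //.
  by move=> x; rewrite -h_eta.
have [h_lin _ _ _] := h_hom.
by apply/(contractiveP h_lin); rewrite /contractive h_norm.
Qed.

(** The contractivity of the restriction to the generators is what makes the
    universal property applicable to it. *)
Lemma free_uniq (B : banachFAlgebraType R) (g h : FE -> B) :
  lattice_algebra_hom g -> lattice_algebra_hom h ->
  (forall x, g (eta x) = h (eta x)) -> (forall x, `|h (eta x)| <= `|x|) -> g = h.
Proof.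
move=> g_hom h_hom gh h_le; case: eta_free => eta_lin _.
have h_lin : linear (h \o eta).
  by case: h_hom => hl _ _ _ a x y /=; rewrite eta_lin hl.
move=> /(_ B (h \o eta) h_lin).
have /(contractiveP h_lin) h_c := h_le.
move=> /(_ h_c) [k [_ _ _ k_uniq]].
by rewrite (k_uniq h)// (k_uniq g)//; apply/funext => x /=; exact: gh.
Qed.

(** The free algebra has no proper part of this kind: the lift of [eta] to [D],
    followed by the inclusion, is the identity by uniqueness, and the lift is
    contractive. *)
Lemma free_subalg (D : banach_subalg FE) :
  (forall x, eta x \in carrier D) -> (forall x, gauge D (eta x) <= `|x|) ->
  forall y, y \in carrier D /\ gauge D y <= `|y|.
Proof.
move=> etaD eta_le y.
pose f x := InSubalg (etaD x).
have f_lin : linear f.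
  by move=> a u v; apply/val_inj; exact: free_lin.
have [h [h_hom h_eta h_le]] := free_lift f_lin (eta_le : forall x, `|f x| <= `|x|).
have hK : @subalg_incl R FE D \o h = id.
  apply: free_uniq => //; first exact: lattice_algebra_hom_comp (subalg_incl_hom D) h_hom.
    by move=> x /=; rewrite h_eta.
  by move=> x; rewrite free_norm.
have hy : subalg_incl (h y) = y by rewrite -[RHS]/(id y) -hK.
by split; rewrite -{1}hy; [exact: subalg_inclP|exact: h_le].
Qed.

End FreeBanachFAlgebra.

(** The instance for the real line, stated for functionals as they occur in the
    dual. *)
Lemma free_lift_scalar (R : realType) (E : completeNormedModType R)
    (FE : banachFAlgebraType R) (eta : E -> FE) (f : E -> R^o) :
  is_FBfA eta -> linear f -> (forall x, `|f x| <= `|x|) ->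
  exists h : FE -> R^o, [/\ lattice_algebra_hom h, forall x, h (eta x) = f x
    & forall a, `|h a| <= `|a|].
Proof.
move=> eta_free f_lin f_le.
exact: (@free_lift R E FE eta eta_free R^o f f_lin f_le).
Qed.

(** * Automatic continuity of the inverse of a bijective homomorphism *)

(** Otherwise there are positive y_n of norm at least 2^n with g (y_n) of norm at
    most 2^-n.  The sum of the g (y_n) exists and is some g z; since [g] reflects
    the order, y_n <= z for all n, which bounds the norms of the y_n. *)
Lemma bijective_hom_bounded_below (R : realType) (A B : banachFAlgebraType R)
    (g : A -> B) : lattice_algebra_hom g -> injective g ->
  (forall y, exists x, g x = y) ->
  exists2 C : R, 0 < C & forall x, `|x| <= C * `|g x|.
Proof.
move=> g_hom g_inj g_surj; have [g_lin _ _ _] := g_hom.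
apply: contrapT => noC.
(* Rescaling to norm 2^-n in the range leaves norm at least 2^n of the 4^n. *)
have /choice[x x_big] n : exists x, 4 ^+ n * `|g x| < `|x|.
  apply: contrapT => no_x; apply: noC; exists (4 ^+ n); first by rewrite exprn_gt0.
  by move=> x; rewrite leNgt; apply/negP => h; apply: no_x; exists x.
have gx0 n : 0 < `|g (x n)|.
  rewrite normr_gt0; apply/eqP => gx0; have := x_big n.
  rewrite gx0 normr0 mulr0 (_ : x n = 0) ?normr0 ?ltxx//.
  by apply: g_inj; rewrite gx0 (lin0 g_lin).
pose y n := (2 ^- n / `|g (x n)|) *: labs (x n).
have c0 n : 0 < 2 ^- n / `|g (x n)| by rewrite divr_gt0// invr_gt0 exprn_gt0.
have y0 n : 0 <=v y n by apply: vscale_ge0; [exact: ltW|exact: labs_ge0].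
have y_big n : 2 ^+ n <= `|y n|.
  rewrite normrZ norm_labs gtr0_norm// mulrAC ler_pdivlMr//.
  have h2 : 0 < 2 ^+ n :> R by rewrite exprn_gt0.
  rewrite ler_pdivlMl// mulrA -exprMn ltW// (_ : 2 * 2 = 4)// -natrM//.
have gy_le n : `|g (y n)| <= 2 ^- n.
  rewrite (linZ g_lin) (hom_labs _ g_hom) normrZ norm_labs gtr0_norm//.
  by rewrite divfK// gt_eqF.
have gy0 n : 0 <=v g (y n).
  rewrite (linZ g_lin) (hom_labs _ g_hom).
  by apply: vscale_ge0; [exact: ltW|exact: labs_ge0].
pose s n := \sum_(k < n) g (y k).
have [n|l s_l] := @fast_cauchy_cvg R B s.
  by rewrite /s big_ord_recr/= [X in X - _]addrC addrK.
have s_mono n k : s n <=v s (n + k)%N.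
  elim: k => [|k IHk]; first by rewrite addn0; exact: vle_refl.
  rewrite addnS {2}/s big_ord_recr/=; apply: (vle_trans IHk).
  exact: vle_addr_ge0.
have s_le n : s n <=v l.
  apply/vsubr_ge0; apply: vge0_norm_small => e /s_l [N hN].
  exists (s (n + N)%N - s n); last by apply/vsubr_ge0.
  by rewrite opprB subrKA hN// leq_addl.
have [z gz] := g_surj l.
have y_le n : y n <=v z.
  apply: (injective_hom_le g_hom g_inj); rewrite gz; apply: vle_trans (s_le n.+1).
  rewrite /s big_ord_recr/= addrC; apply: vle_addr_ge0.
  have := s_mono 0%N n; rewrite add0n /s big_ord0//.
pose n := Num.bound `|z|.
have := vle_norm (y0 n) (y_le n); rewrite leNgt => /negP; apply.
apply: lt_le_trans (y_big n); apply: lt_trans (archi_boundP (normr_ge0 z)) _.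
by rewrite -natrX ltr_nat ltn_expl.
Qed.

(** * Density, quotient maps and pointwise convergence *)

Lemma dense_rangeP (R : realType) (V : Type) (W : normedModType R) (f : V -> W) :
  dense (range f) <-> forall y e, 0 < e -> exists x, `|y - f x| <= e.
Proof.
split=> [f_dense y e e0|f_dense O [y Oy] O_open].
  have [|z []] := f_dense (ball y e) _ (ball_open y e).
    by exists y; exact: ballxx.
  rewrite -ball_normE /= => yz [x _ fx]; exists x; rewrite fx; exact: ltW.
have /nbhs_ballP[e /= e0 eO] := open_nbhs_nbhs (conj O_open Oy).
have e20 : 0 < e / 2 by rewrite divr_gt0.
have [x yx] := f_dense y _ e20.
exists (f x); split; last by exists x.
apply: eO; rewrite -ball_normE /= (le_lt_trans yx)//.
by rewrite ltr_pdivrMr// ltr_pMr// ltr1n.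
Qed.

Lemma ptws_closure_approx (R : realType) (E : normedModType R) (S : set (E -> R^o))
    (f : E -> R^o) x (e : R) :
  closure (S : set {ptws E -> R^o}) f -> 0 < e ->
  exists2 g, S g & `|f x - g x| <= e.
Proof.
move=> /(_ [set g : {ptws E -> R^o} | `|f x - g x| <= e]) Sf e0.
have [|g [Sg fg]] := Sf; last by exists g.
have eval_continuous : {for (f : {ptws E -> R^o}),
    continuous (fun g : {ptws E -> R^o} => g x)}.
  exact: (@proj_continuous E (fun=> R^o) x f).
by have /cvgrPdist_le /(_ _ e0) := eval_continuous.
Qed.

Lemma bounded_linear_continuous (R : realType) (V : normedModType R) (f : V -> R^o) :
  linear f -> (forall x, `|f x| <= `|x|) -> continuous f.
Proof.
move=> f_lin f_le x; apply/cvgrPdist_le => e e0.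
near=> z; rewrite -(linB f_lin) (le_trans (f_le _)) //.
Unshelve. all: by end_near. Qed.

Lemma quotient_map_lift (R : realType) (V W : normedModType R) (f : V -> W) (y : W)
    (e : R) : linear f -> quotient_map f -> 0 < e ->
  exists2 x, f x = y & `|x| <= `|y| + e.
Proof.
move=> f_lin [f_surj f_quo] e0; have [x <-] := f_surj y.
have [|_ [n /= fn <-] /ltW xn] :=
    @inf_adherent R [set `|x + n| | n in f @^-1` [set 0]] e e0.
  split; last by exists 0 => _ [n _ <-].
  by exists `|x + 0|, 0 => //=; rewrite (lin0 f_lin).
exists (x + n); first by rewrite (linD f_lin) fn addr0.
by rewrite f_quo.
Qed.

(** * The induced homomorphism *)

Section Induced.
Context (R : realType) (E F : completeNormedModType R).
Context (FE FF : banachFAlgebraType R) (etaE : E -> FE) (etaF : F -> FF).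
Hypotheses (hE : is_FBfA etaE) (hF : is_FBfA etaF).
Context (T : E -> F).
Hypotheses (T_lin : linear T) (T_c : contractive T).
Context (Tbar : FE -> FF).
Hypothesis hTbar : is_induced_hom etaE etaF T Tbar.

Let T_le x : `|T x| <= `|x|.
Proof. exact: (proj1 (contractiveP T_lin)). Qed.

Let Tbar_hom : lattice_algebra_hom Tbar.
Proof. by case: hTbar. Qed.

Let Tbar_lin : linear Tbar.
Proof. by case: Tbar_hom. Qed.

Let Tbar_le a : `|Tbar a| <= `|a|.
Proof.
by apply/(contractiveP Tbar_lin): a; case: hTbar => _ Tn _; rewrite /contractive Tn.
Qed.

Let Tbar_eta x : Tbar (etaE x) = etaF (T x).
Proof. by case: hTbar => _ _ /(congr1 (fun f => f x)). Qed.

Lemma induced_dense_range : dense (range T) -> dense (range Tbar).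
Proof.
move=> /dense_rangeP T_dense; apply/dense_rangeP => b e e0.
have [|//|bP _] := @free_subalg _ _ _ _ hF (closure_subalg Tbar_hom) _ _ b.
  move=> y; apply/in_closureP => d d0; have [x yx] := T_dense y d d0.
  exists (etaE x); rewrite Tbar_eta -(linB (free_lin hF)) (free_norm hF) //.
  by move=> y /=; rewrite (free_norm hF).
by move/in_closureP: bP; apply.
Qed.

(** If [y] has distance at least e from the range of [T], some functional [f] of
    norm at most one vanishes on that range and has f y >= e.  Its extension to
    [FF] composed with [Tbar] extends the zero functional on [E], so it is zero. *)
Lemma dense_range_of_induced : dense (range Tbar) -> dense (range T).
Proof.
move=> /dense_rangeP Tbar_dense; apply/dense_rangeP => y e e0.
apply: contrapT => no_x.
have y_far x : e <= `|y - T x|.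
  by rewrite leNgt; apply/negP => h; apply: no_x; exists x; exact: ltW.
pose C z r := exists t x, [/\ 0 <= t, z = t *: y - T x & r = t * e].
have [||||f [f_lin f_le f_C]] := @hahn_banach R F C.
- by exists 0, 0; rewrite scale0r (lin0 T_lin) subr0 mul0r.
- move=> _ _ _ _ [t [x [t0 -> ->]]] [s [z [s0 -> ->]]]; exists (t + s), (x + z).
  by rewrite addr_ge0// scalerDl (linD T_lin) opprD addrACA mulrDl.
- move=> s _ _ s0 [t [x [t0 -> ->]]]; exists (s * t), (s *: x).
  by rewrite mulr_ge0 ?(ltW s0)// scalerBr scalerA (linZ T_lin) mulrA.
- move=> _ _ [t [x [t0 -> ->]]].
  have [->|tn0] := eqVneq t 0; first by rewrite mul0r normr_ge0.
  rewrite -[x](scalerKV tn0) (linZ T_lin) -scalerBr normrZ ger0_norm//.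
  exact: ler_wpM2l.
have fT x : f (T x) = 0.
  apply/le_anti/andP; split; last first.
    by apply: f_C; exists 0, (- x); rewrite scale0r (linN T_lin) opprK add0r mul0r.
  rewrite -oppr_ge0 -(linN f_lin); apply: f_C.
  by exists 0, x; rewrite scale0r add0r mul0r.
have [fhat [fhat_hom fhat_eta fhat_le]] := free_lift_scalar hF f_lin f_le.
have [fhat_lin _ _ _] := fhat_hom.
have zero_hom : lattice_algebra_hom (fun _ : FE => 0 : R^o).
  split=> [a u v|u v|u v|u v].
  - by rewrite scaler0 addr0.
  - by rewrite /vmeet/= minxx.
  - by rewrite /vjoin/= maxxx.
  - by rewrite vmul0l.
have fTbar : fhat \o Tbar = (fun=> 0).
  apply: (free_uniq hE) => //; first exact: lattice_algebra_hom_comp.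
    by move=> x /=; rewrite Tbar_eta fhat_eta fT.
  by move=> x; rewrite normr0.
have fhat0 : fhat (etaF y) = 0.
  apply/normr0_eq0/le_anti; rewrite normr_ge0 andbT; apply/ler_addgt0Pr => d d0.
  have [a ya] := Tbar_dense (etaF y) d d0.
  have := fhat_le (etaF y - Tbar a); rewrite (linB fhat_lin).
  have -> : fhat (Tbar a) = 0 by exact: (congr1 (fun h => h a) fTbar).
  by rewrite subr0 add0r => /le_trans; apply.
have : e <= f y.
  by apply: f_C; exists 1, 0; rewrite scale1r (lin0 T_lin) subr0 mul1r ler01.
by rewrite -fhat_eta fhat0 leNgt e0.
Qed.

(** The range of [Tbar] with the quotient norm contains the generators
    contractively, exactly because [T] is a quotient map. *)
Lemma induced_quotient_map : quotient_map T -> quotient_map Tbar.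
Proof.
move=> T_quo; pose D := range_subalg Tbar_hom Tbar_le.
have D_all b : b \in carrier D /\ gauge D b <= `|b|.
  apply: (free_subalg hF) => y.
    have [x <-] := T_quo.1 y; apply/in_rangeP; exists (etaE x); exact: Tbar_eta.
  apply/ler_addgt0Pr => e e0; have [x <- xy] := quotient_map_lift y T_lin T_quo e0.
  rewrite -Tbar_eta (le_trans (range_norm_le _ _))// (free_norm hE)//.
split=> [b|a].
  by have [/in_rangeP] := D_all b.
apply/le_anti/andP; split.
  apply: lb_le_inf.
    by exists `|a + 0|, 0 => //=; rewrite (lin0 Tbar_lin).
  move=> _ [n /= Tn <-]; rewrite -[Tbar a]addr0 -Tn -(linD Tbar_lin); exact: Tbar_le.
apply/ler_addgt0Pr => e e0; have [_ a_le] := D_all (Tbar a).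
have [a' Ta' a'_le] := range_norm_adherent Tbar a e0.
apply: le_trans (lerD a_le (lexx e)); apply: le_trans a'_le.
apply: ge_inf; first by exists 0 => _ [n _ <-].
exists (a' - a); last by rewrite addrC subrK.
by rewrite /= (linB Tbar_lin) Ta' subrr.
Qed.

(** [T] is bounded below because it is the restriction of [Tbar] to the
    generators, so approximate preimages of [y] converge. *)
Lemma bijective_of_induced : bijective Tbar -> bijective T.
Proof.
move=> [S TbarK SK]; have Tbar_inj := can_inj TbarK.
have Tbar_surj b : exists a, Tbar a = b by exists (S b); exact: SK.
have [C C0 TbarC] := bijective_hom_bounded_below Tbar_hom Tbar_inj Tbar_surj.
have T_below x : `|x| <= C * `|T x|.
  by rewrite -(free_norm hE) -(free_norm hF) -Tbar_eta.
have T_inj : injective T.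
  move=> x z Txz; apply/eqP; rewrite -subr_eq0 -normr_le0.
  by rewrite (le_trans (T_below _))// (linB T_lin) Txz subrr normr0 mulr0.
have /dense_rangeP T_dense : dense (range T).
  apply: dense_range_of_induced; apply/dense_rangeP => b e e0.
  by have [a <-] := Tbar_surj b; exists a; rewrite subrr normr0 ltW.
have T_surj y : exists x, T x = y.
  (* The tolerance is chosen for the approximate preimages to be a fast Cauchy
     sequence after multiplication by C. *)
  have d0 n : 0 < 2 ^- n / (2 * C) :> R.
    by rewrite divr_gt0 ?mulr_gt0// invr_gt0 exprn_gt0.
  have /choice[x x_y] n := T_dense y _ (d0 n).
  have [n|l xl] := @fast_cauchy_cvg R E x.
    rewrite (le_trans (T_below _))// mulrC -ler_pdivlMr//.
    rewrite (linB T_lin) -(subrKA y) (le_trans (ler_normD _ _))//.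
    rewrite (le_trans (lerD (_ : _ <= 2 ^- n.+1 / (2 * C)) (x_y n)) _)//.
      by rewrite distrC; exact: x_y.
    have h2 : 0 < 2 ^- n / C :> R by rewrite divr_gt0// invr_gt0 exprn_gt0.
    have -> : 2 ^- n / (2 * C) = 2 ^- n / C / 2 by rewrite invfM mulrCA mulrC.
    have -> : 2 ^- n.+1 / (2 * C) = 2 ^- n / C / 4.
      by rewrite exprS -[4]/(2 * 2)%:R natrM !invfM; ring.
    by lra.
  exists l; apply/eqP; rewrite -subr_eq0 -normr_le0; apply/ler_addgt0Pr => e e0.
  have e20 : 0 < e / 2 by rewrite divr_gt0.
  have [N hN] := xl _ e20.
  have [M hM] := exists_pow2_le (mulr_gt0 e20 (mulr_gt0 (ltr0Sn R 1) C0)).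
  pose n := maxn N M.
  rewrite add0r -(subrKA (T (x n))) (le_trans (ler_normD _ _))// [leRHS]splitr.
  apply: lerD.
    by rewrite -(linB T_lin) (le_trans (T_le _))// hN// leq_maxl.
  by rewrite distrC (le_trans (x_y n))// ler_pdivrMr ?mulr_gt0// hM// leq_maxr.
have /choice[T' T'K] := T_surj.
by exists T' => // x; apply: T_inj; rewrite T'K.
Qed.

(** Choose c strictly between |T x| and f x, and let a be the modulus of the
    generator [etaE x].  Then a a <= c a holds after applying [Tbar], by
    [vmul_le_norm], hence before; applying the extension of [f] contradicts
    c < f x. *)
Lemma dual_ball_le_of_induced_injective (f : E -> R^o) x : injective Tbar ->
  dual_ball f -> f x <= `|T x|.
Proof.
move=> Tbar_inj [[f_lin _] /(contractiveP f_lin) f_le].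
rewrite leNgt; apply/negP => Tf.
pose c := (`|T x| + f x) / 2.
have Tc : `|T x| < c by rewrite /c ltr_pdivlMr//; lra.
have cf : c < f x by rewrite /c ltr_pdivrMr//; lra.
have c0 : 0 < c by exact: le_lt_trans Tc.
have [fhat [fhat_hom fhat_eta _]] := free_lift_scalar hE f_lin f_le.
have [fhat_lin _ _ fhatM] := fhat_hom.
pose a := labs (etaE x).
have : (a * a)%g <=v c *: a.
  apply: (injective_hom_le Tbar_hom Tbar_inj).
  have [_ _ _ ->] := Tbar_hom; rewrite (linZ Tbar_lin).
  have -> : Tbar a = labs (etaF (T x)) by rewrite /a (hom_labs _ Tbar_hom) Tbar_eta.
  by apply: vmul_le_norm; rewrite ?norm_labs ?(free_norm hF)//; exact: labs_ge0.
move=> aa; have : fhat (a * a)%g <= c * fhat a.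
  by have := hom_le fhat_hom aa; rewrite (linZ fhat_lin).
have fa : fhat a = f x.
  rewrite /a (hom_labs _ fhat_hom) fhat_eta labs_scalar ger0_norm//.
  by apply/ltW/(lt_trans c0).
rewrite fhatM fa leNgt => /negP; apply.
by rewrite ltr_pM2r// (lt_trans c0).
Qed.

(** The constraints f x <= g (T x) are compatible with the norm bound on [g];
    being symmetric in [x], they are equalities. *)
Lemma dual_ball_factor (f : E -> R^o) : dual_ball f ->
  (forall x, f x <= `|T x|) ->
  exists2 g : F -> R^o, dual_ball g & g \o T = f.
Proof.
move=> [[f_lin _] _] f_T.
pose C y r := exists2 x, y = T x & r = f x.
have [||||g [g_lin g_le g_C]] := @hahn_banach R F C.
- by exists 0; rewrite ?(lin0 T_lin) ?(lin0 f_lin).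
- by move=> _ _ _ _ [x -> ->] [z -> ->]; exists (x + z);
    rewrite ?(linD T_lin) ?(linD f_lin).
- by move=> t _ _ _ [x -> ->]; exists (t *: x); rewrite ?(linZ T_lin) ?(linZ f_lin).
- by move=> _ _ [x -> ->].
exists g.
  split; last exact/contractiveP.
  by split=> //; exact: bounded_linear_continuous.
apply/funext => x /=; apply/le_anti/andP; split; last by apply: g_C; exists x.
rewrite -lerN2 -(linN g_lin) -(linN f_lin) -(linN T_lin).
by apply: g_C; exists (- x).
Qed.

Lemma weak_star_dense_of_induced_injective : injective Tbar ->
  weak_star_dense_in (adjoint T @` @dual_ball R F) (@dual_ball R E).
Proof.
move=> Tbar_inj f fB; apply: subset_closure.
have [|g gB gT] := dual_ball_factor fB; last by exists g.
by move=> x; exact: dual_ball_le_of_induced_injective.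
Qed.

(** Density makes every functional of the dual ball factor through [T], so every
    contractive real-valued homomorphism of [FE] factors through [Tbar]. *)
Lemma induced_injective : semiprime FE ->
  weak_star_dense_in (adjoint T @` @dual_ball R F) (@dual_ball R E) ->
  injective Tbar.
Proof.
move=> FE_semiprime T_dense.
have f_T f x : dual_ball f -> f x <= `|T x|.
  move=> /T_dense f_cl; apply/ler_addgt0Pr => e e0.
  have [_ [g [[g_lin _] /(contractiveP g_lin) g_le] <-] fg] :=
    ptws_closure_approx x f_cl e0.
  rewrite -lerBlDl (le_trans (lerB (lexx _) (g_le (T x))))//.
  rewrite (le_trans _ fg)// (le_trans _ (ler_norm _))// lerB//.
  exact: ler_norm.
have ker0 a : 0 <=v a -> Tbar a = 0 -> a = 0.
  move=> a0 Ta0; apply: FE_semiprime; apply: contrapT => aa.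
  have [phi [phi_hom phi_le /eqP]] := exists_character a0 aa; apply.
  have [phi_lin _ _ _] := phi_hom.
  pose f := phi \o etaE.
  have f_lin : linear (f : E -> R^o).
    by move=> t u v; rewrite /f/= (free_lin hE) phi_lin.
  have f_le x : `|f x| <= `|x| by rewrite -(free_norm hE); exact: phi_le.
  have fB : dual_ball (f : E -> R^o).
    split; last exact/(contractiveP f_lin).
    by split=> //; exact: bounded_linear_continuous.
  have [|g [[g_lin _] /(contractiveP g_lin) g_le] gT] := dual_ball_factor fB.
    by move=> x; exact: f_T.
  have [ghat [ghat_hom ghat_eta _]] := free_lift_scalar hF g_lin g_le.
  have -> : phi = ghat \o Tbar.
    symmetry; apply: (free_uniq hE) => //; first exact: lattice_algebra_hom_comp.
    by move=> x /=; rewrite Tbar_eta ghat_eta -[phi _]/(f x) -gT.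
  by rewrite /= Ta0; apply: lin0; case: ghat_hom.
move=> a b Tab; apply/eqP; rewrite -subr_eq0 -normr_eq0 -norm_labs normr_eq0.
apply/eqP/ker0; first exact: labs_ge0.
rewrite (hom_labs _ Tbar_hom) (linB Tbar_lin) Tab subrr labs_id//; exact: vle_refl.
Qed.

End Induced.

Theorem proposition6p10 (R : realType) (E F : completeNormedModType R)
  (FE FF : banachFAlgebraType R) (etaE : E -> FE) (etaF : F -> FF)
  (hE : is_FBfA etaE) (hF : is_FBfA etaF)
  (T : E -> F) (T_linear : linear T) (T_contractive : contractive T)
  (Tbar : FE -> FF) (hTbar : is_induced_hom etaE etaF T Tbar) :
  [/\ dense (range Tbar) <-> dense (range T),
      quotient_map T -> quotient_map Tbar,
      bijective Tbar -> bijective T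
    & semiprime FE -> semiprime FF ->
      (injective Tbar <->
       weak_star_dense_in (adjoint T @` @dual_ball R F) (@dual_ball R E))].
Proof.
split.
- split; first exact (dense_range_of_induced hE hF T_linear hTbar).
  exact (induced_dense_range hF hTbar).
- exact (induced_quotient_map hE hF T_linear T_contractive hTbar).
- exact (bijective_of_induced hE hF T_linear T_contractive hTbar).
- move=> FE_semiprime _; split.
    exact (weak_star_dense_of_induced_injective hE hF T_linear hTbar).
  exact (induced_injective hE hF T_linear hTbar FE_semiprime).
Qed.
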